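(* Consider a single point-like scatterer at $\vec y_*=(y_*,L+\eta_* )$ with symmetric polarizability tensor $\boldsymbol\alpha_*\in\mathbb C^{3\times3}$, $\|\boldsymbol\alpha_*\|=\mathcal O(1)$. In the Fraunhofer regime, the active Kirchhoff imaging function satisfies, for all imaging points $\vec y=(y,L+\eta_* )$ with $y\ne y_*$, $$\|\mathbb I_{\mathrm{KM}}(\vec y;k)\|\le\frac{a^4}{L^4}\left[\mathcal O\Big(\Big(\frac{L}{a\,k\,\|y-y_*\|}\Big)^2\Big)+o(1)\right],$$ where the $o(1)$ is explicitly given by $\mathcal O(a^4\Theta_a^2/L^4)+\mathcal O(\Theta_b^2)$. When the array $\mathcal A$ is a disk of radius $a$, one has $$\mathbb I_{\mathrm{KM}}(\vec y_*;k)=\frac{a^4}{(16\pi)^2L^4}\begin{pmatrix}\boldsymbol\alpha_{*;1:2,1:2}&\boldsymbol 0\\ \boldsymbol 0&0\end{pmatrix}+o\Big(\frac{a^4}{L^4}\Big),$$ where $\boldsymbol\alpha_{*;1:2,1:2}$ is the leading $2\times2$ principal block of $\boldsymbol\alpha_*$.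
   Context: Notation. Points of $\mathbb R^3$ are written $\vec x=(x,z)$ with $x\in\mathbb R^2$ the cross-range part and $z$ the range part; $k>0$ is the wavenumber. With $\vec r=\vec x-\vec y$, $r=\|\vec r\|$, $m(kr)=(\mathrm i kr-1)/(kr)^2$, and $G(\vec x,\vec y;k)=\frac{e^{\mathrm i k\|\vec x-\vec y\|}}{4\pi\|\vec x-\vec y\|}$, the dyadic Green function is the $3\times3$ matrix $$\mathbb G(\vec x,\vec y;k)=G(\vec x,\vec y;k)\Big[(1+m(kr))\mathbb I-(1+3m(kr))\frac{\vec r\,\vec r^{\top}}{r^2}\Big].$$ Array, data, image. The array of collocated sources and receivers is $\mathcal A\subset\mathbb R^2$ of characteristic size $a$, i.e. $\mathcal A=a\widetilde{\mathcal A}$ with $\widetilde{\mathcal A}\subset\mathbb R^2$ a fixed bounded domain with piecewise smooth boundary (a disk array of radius $a$ is $\{x_r\in\mathbb R^2:\|x_r\|\le a\}$); receivers and sources are $\vec x_r=(x_r,0)$, $\vec x_s=(x_s,0)$ with $x_r,x_s\in\mathcal A$. The data are the array response function (Born approximation) $\Pi(x_r,x_s;k)=\mathbb G(\vec x_r,\vec y_*;k)\,\boldsymbol\alpha_*\,\mathbb G(\vec y_*,\vec x_s;k)$, and the active Kirchhoff imaging function is the $3\times3$ matrix $$\mathbb I_{\mathrm{KM}}(\vec y;k)=\int_{\mathcal A}\int_{\mathcal A}\overline{\mathbb G(\vec x_r,\vec y;k)}\,\Pi(x_r,x_s;k)\,\overline{\mathbb G(\vec x_s,\vec y;k)}\,\mathrm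 dx_r\,\mathrm dx_s .$$ Fraunhofer regime. Imaging points and the scatterer position lie in the imaging window: they are of the form $(y,L+\eta)$ with $\|y\|=\mathcal O(b)$ and $|\eta|=\mathcal O(h)$. Put $\Theta_a=ka^2/L$, $\Theta_b=kb^2/L$, $\Theta_h=kh^2/L$. The parameters $(k,L,a,b,h)$ vary so that $kL\gg1$, $a\ll L$, $b\ll L$, $h\ll L$, $\Theta_b\ll1$, $1\ll\Theta_a\ll L^2/a^2$ and $kh=\mathcal O(1)$, where $X\ll Y$ means $X/Y\to0$. The symbols $\mathcal O$, $o$ refer to this limit, uniformly over points of the imaging window. *)

(* Defs.v *)
From mathcomp Require Import all_boot all_order all_algebra.
From mathcomp Require Import all_classical all_reals all_analysis.
From mathcomp Require Import complex.

Set Implicit Arguments.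
Unset Strict Implicit.
Unset Printing Implicit Defensive.

Import Order.TTheory GRing.Theory Num.Theory.
Import numFieldNormedType.Exports.

Local Open Scope ring_scope.
Local Open Scope classical_set_scope.
Local Open Scope complex_scope.

Section Geometry.
Context {R : realType}.

(* Euclidean norm on R^2; the library norm on R * R is the sup norm. *)
Definition enorm2 (x : R * R) : R := Num.sqrt (x.1 ^+ 2 + x.2 ^+ 2).

(* Euclidean norm on R^3; the library norm on 'cV_3 is the sup norm. *)
Definition enorm3 (v : 'cV[R]_3) : R := Num.sqrt (\sum_i v i 0 ^+ 2).

Definition point3 (x : R * R) (z : R) : 'cV[R]_3 :=
  \col_i [:: x.1; x.2; z]`_i.

(* Simple regular C^1 arc parametrized by [0, 1].  Asking for a C^1 function on
   the whole line loses nothing: a C^1 function on [0, 1] extends. *)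
Definition regular_arc (g : R -> R * R) : Prop :=
  [/\ forall s, derivable g s 1,
      continuous g^`(),
      forall s, `[0, 1]%classic s -> g^`() s != 0 &
      {in `[0, 1] &, injective g}].

(* Finite union of regular arcs, any two of which meet only at endpoints. *)
Definition piecewise_smooth_curve (S : set (R * R)) : Prop :=
  exists (N : nat) (g : 'I_N -> R -> R * R),
    [/\ forall i, regular_arc (g i),
        forall i j s t, i != j -> `[0, 1]%classic s -> `[0, 1]%classic t ->
          g i s = g j t -> [set 0; 1] s /\ [set 0; 1] t &
        S = \bigcup_i (g i @` `[0, 1]%classic)].

(* The set may contain any (Borel) part of its boundary, so that open as well
   as closed disks are allowed; up to boundary points it is the open connected
   set A°. *)
Definition bounded_piecewise_smooth_domain (A : set (R * R)) : Prop :=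
  [/\ bounded_set A, measurable A,
      A° !=set0 /\ connected A°,
      A `<=` closure A° &
      piecewise_smooth_curve (closure A `\` A°)].

Definition scaled_array (a : R) (A : set (R * R)) : set (R * R) :=
  (fun x => (a * x.1, a * x.2)) @` A.

Definition disk_array (a : R) : set (R * R) := [set x | enorm2 x <= a].

End Geometry.

Section Imaging.
Context {R : realType}.
Local Notation C := R[i].

Definition conj_mx (M : 'M[C]_3) : 'M[C]_3 := map_mx (@conjc R) M.

(* Frobenius norm *)
Definition fnorm (M : 'M[C]_3) : R :=
  Num.sqrt (\sum_i \sum_j Normc.normc (M i j) ^+ 2).

(* exp (i t) *)
Definition expi (t : R) : C := cos t +i* sin t.

Definition area := (@lebesgue_measure R \x @lebesgue_measure R)%E.

Definition integralC (A : set (R * R)) (f : R * R -> C) : C :=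
  (\int[area]_(x in A) complex.Re (f x)) +i*
  (\int[area]_(x in A) complex.Im (f x)).

Definition integral_mx (A : set (R * R)) (f : R * R -> 'M[C]_3) : 'M[C]_3 :=
  \matrix_(i, j) integralC A (fun x => f x i j).

Definition mfac (s : R) : C := ((s%:C * 'i) - 1) / (s ^+ 2)%:C.

Definition green (k : R) (x y : 'cV[R]_3) : C :=
  expi (k * enorm3 (x - y)) / (4 * pi * enorm3 (x - y))%:C.

Definition dyadic_green (k : R) (x y : 'cV[R]_3) : 'M[C]_3 :=
  let rv := x - y in
  let r := enorm3 rv in
  green k x y *:
    ((1 + mfac (k * r)) *: 1%:M -
     ((1 + 3 * mfac (k * r)) / (r ^+ 2)%:C) *:
       map_mx (fun u : R => u%:C) (rv *m rv^T)).

Definition array_response (k : R) (ystar : 'cV[R]_3) (alpha : 'M[C]_3)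
    (xr xs : R * R) : 'M[C]_3 :=
  dyadic_green k (point3 xr 0) ystar *m alpha *m
  dyadic_green k ystar (point3 xs 0).

Definition kirchhoff_image (A : set (R * R)) (k : R) (ystar : 'cV[R]_3)
    (alpha : 'M[C]_3) (y : 'cV[R]_3) : 'M[C]_3 :=
  integral_mx A (fun xs => integral_mx A (fun xr =>
    conj_mx (dyadic_green k (point3 xr 0) y) *m
    array_response k ystar alpha xr xs *m
    conj_mx (dyadic_green k (point3 xs 0) y))).

(* The matrix whose leading 2 x 2 block is that of M, zero elsewhere. *)
Definition cross_range_block (M : 'M[C]_3) : 'M[C]_3 :=
  block_mx (ulsubmx (M : 'M[C]_(2 + 1))) 0 0 (0 : 'M[C]_1).

End Imaging.

Section Regime.
Context {R : realType} {T : Type} (F : filter_on T).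

Definition much_less (X Y : T -> R) : Prop := (fun t => X t / Y t) @ F --> 0.

Definition Theta (k L l : T -> R) (t : T) : R := k t * l t ^+ 2 / L t.

(* The limit is taken along an arbitrary proper filter F on an index set T of
   the parameters. *)
Record fraunhofer (k L a b h : T -> R) : Prop := Fraunhofer {
  fraunhofer_pos : forall t, [/\ 0 < k t, 0 < L t, 0 < a t, 0 < b t & 0 < h t];
  fraunhofer_kL : much_less (cst 1) (k \* L);
  fraunhofer_aL : much_less a L;
  fraunhofer_bL : much_less b L;
  fraunhofer_hL : much_less h L;
  fraunhofer_Thetab : much_less (Theta k L b) (cst 1);
  fraunhofer_Thetaa : much_less (cst 1) (Theta k L a);
  fraunhofer_Thetaa_ub :
    much_less (Theta k L a) (fun t => L t ^+ 2 / a t ^+ 2);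
  fraunhofer_kh : (k \* h : T -> R) =O_F (cst 1 : T -> R)
}.

End Regime.

(* (y, L + eta) is in the imaging window with O-constant c. *)
Definition in_window {R : realType} (c b h : R) (y : R * R) (eta : R) : Prop :=
  enorm2 y <= c * b /\ `|eta| <= c * h.

(* Main.v *)
From HB Require Import structures.
Require Import Defs.
From mathcomp Require Import all_boot all_order all_algebra.
From mathcomp Require Import all_classical all_reals all_analysis.
From mathcomp Require Import measurable_realfun complex ring lra.

Set Implicit Arguments.
Unset Strict Implicit.
Unset Printing Implicit Defensive.

Import Order.TTheory GRing.Theory Num.Theory.
Import numFieldNormedType.Exports.

Local Open Scope ring_scope.
Local Open Scope classical_set_scope.
Local Open Scope complex_scope.

(* By reciprocity, the image at y of a scatterer at y' is H alpha H^T, where H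
   is the integral over the array of conj(G(x, y)) G(x, y').  Up to a relative
   error O(a / L + k a^4 / L^3), the integrand is (4 pi L)^-2 times a plane wave
   in x, of wave vector k (y - y') / L, times the projection on the cross-range
   plane.

   For y = y' the plane wave is constant and H is proportional to the area of
   the array.  For y <> y', translating the array by half a period changes the
   sign of the wave, so only a layer around the boundary contributes; the area
   of the layer is O(a) times its width L / (k |y - y'|), because the boundary
   has finite length.  The error a / L is absorbed by AM-GM in the other two
   terms. *)

(** * Translations of the plane and half periods *)

(* [area] is a measure on this type, whose measurable structure is only
   convertible to the default one on [R * R]. *)
Notation plane R := (measurableTypeR R * measurableTypeR R)%type.

Lemma measurable_addr (R : realType) (v : R) :
  measurable_fun [set: measurableTypeR R]
    (fun x : measurableTypeR R => x + v : measurableTypeR R).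
Proof.
apply: (@measurable_funD _ (measurableTypeR R) R setT idfun (cst v)).
  exact: measurable_id.
exact: measurable_cst.
Qed.

Lemma lebesgue_measure_translate (R : realType) (v : R) (X : set R) :
  measurable X -> lebesgue_measure ((fun x => x + v) @^-1` X) = lebesgue_measure X.
Proof.
move=> mX.
pose h : {mfun measurableTypeR R >-> measurableTypeR R} :=
  HB.pack (fun x : R => x + v) (isMeasurableFun.Build _ _ _ _ _ (measurable_addr v)).
have := @lebesgue_measure_unique R (pushforward lebesgue_measure h) _ X mX.
move=> -> // _ [[s t] _ <-]/=.
rewrite /pushforward (_ : _ @^-1` _ = `](s - v), (t - v)]%classic).
  rewrite !lebesgue_measure_itv/= !lte_fin ltrD2r.
  by case: ifPn => // _; rewrite -!EFinD; congr (_%:E); ring.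
by apply/seteqP; split => x /=; rewrite !in_itv/= ltrBlDr lerBrDr.
Qed.

Lemma measurable_translate (R : realType) (v : R * R) :
  measurable_fun [set: plane R] (fun x : plane R => (x : R * R) + v : plane R).
Proof.
rewrite (_ : (fun _ => _) = (fun x : R * R => (x.1 + v.1, x.2 + v.2))).
  apply: measurable_fun_pair.
    apply: (@measurable_funD _ _ R setT fst (cst v.1)).
      exact: measurable_fst.
    exact: measurable_cst.
  apply: (@measurable_funD _ _ R setT snd (cst v.2)).
    exact: measurable_snd.
  exact: measurable_cst.
by apply/funext => -[].
Qed.

Lemma area_setX (R : realType) (A B : set (measurableTypeR R)) :
  measurable A -> measurable B ->
  area (A `*` B) = (lebesgue_measure A * lebesgue_measure B)%E.
Proof. by move=> mA mB; exact: product_measure1E. Qed.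

Lemma area_translate (R : realType) (v : R * R) (X : set (R * R)) :
  measurable (X : set (plane R)) -> area ((fun x => x + v) @^-1` X) = area X.
Proof.
move=> mX.
pose h : {mfun plane R >-> plane R} :=
  HB.pack (fun x : plane R => (x : R * R) + v : plane R)
    (isMeasurableFun.Build _ _ _ _ _ (measurable_translate v)).
rewrite -[LHS]/(pushforward area h X) -[RHS]/((lebesgue_measure \x lebesgue_measure)%E X).
apply/esym; apply: (@product_measure_unique _ _ _ _ _ _ _ (pushforward area h)) => //.
move=> A B mA mB.
have mA' : measurable ((fun x : measurableTypeR R => x + v.1 : measurableTypeR R) @^-1` A).
  by rewrite -[X in measurable X]setTI; exact: measurable_addr.
have mB' : measurable ((fun x : measurableTypeR R => x + v.2 : measurableTypeR R) @^-1` B).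
  by rewrite -[X in measurable X]setTI; exact: measurable_addr.
transitivity (area (((fun x => x + v.1) @^-1` A) `*` ((fun x => x + v.2) @^-1` B))) => //.
rewrite area_setX//.
by congr (_ * _)%E; exact: lebesgue_measure_translate.
Qed.

Definition box (R : realType) (p : R * R) (r : R) : set (R * R) :=
  `[p.1 - r, p.1 + r]%classic `*` `[p.2 - r, p.2 + r]%classic.

Lemma measurable_box (R : realType) (p : R * R) (r : R) : measurable (box p r : set (plane R)).
Proof. by apply: measurableX; exact: measurable_itv. Qed.

Lemma area_box (R : realType) (p : R * R) (r : R) : 0 <= r ->
  area (box p r) = (4 * r ^+ 2)%:E.
Proof.
move=> r0; rewrite /box area_setX; [|exact: measurable_itv..].
rewrite !lebesgue_measure_itv/= !lte_fin.
have [r1|] := ltP 0 r; last first.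
  move=> r1; have -> : r = 0 by lra.
  by rewrite !subr0 !addr0 !ltxx mule0 expr0n mulr0.
have -> : p.1 - r < p.1 + r by lra.
have -> : p.2 - r < p.2 + r by lra.
by rewrite -!EFinB -EFinM; congr (_%:E); ring.
Qed.

Lemma boxP (R : realType) (p x : R * R) (r : R) :
  box p r x <-> `|x.1 - p.1| <= r /\ `|x.2 - p.2| <= r.
Proof. by rewrite /box /= !in_itv/= !ler_distl. Qed.

Lemma area_lty (R : realType) (A : set (R * R)) (r : R) :
  measurable (A : set (plane R)) -> A `<=` box 0 r -> (area A < +oo)%E.
Proof.
move=> mA Ar; apply: (@le_lt_trans _ _ (area (box (0 : R * R) `|r|))).
  apply: le_measure; rewrite ?inE//; first exact: measurable_box.
  move=> x /Ar /boxP[h1 h2]; apply/boxP; split.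
    exact: (le_trans h1 (ler_norm _)).
  exact: (le_trans h2 (ler_norm _)).
by rewrite area_box// ltry.
Qed.

Lemma bounded_integrable (R : realType) (A : set (R * R)) (f : R * R -> R) (r K : R) :
  measurable (A : set (plane R)) -> A `<=` box 0 r -> measurable_fun (A : set (plane R)) f ->
  (forall x, A x -> `|f x| <= K) -> area.-integrable A (EFin \o f).
Proof.
move=> mA Ar mf fK; apply: measurable_bounded_integrable => //.
  exact: area_lty Ar.
exists K; split; first exact: num_real.
by move=> y Ky x Ax; exact: le_trans (fK x Ax) (ltW Ky).
Qed.

Lemma measurable_translate_preimage (R : realType) (v : R * R) (A : set (R * R)) :
  measurable (A : set (plane R)) -> measurable ((fun x => x + v) @^-1` A : set (plane R)).
Proof.
move=> mA; rewrite -[X in measurable X]setTI; exact: measurable_translate.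
Qed.

Lemma translate_preimage_box (R : realType) (v : R * R) (A : set (R * R)) (r : R) :
  A `<=` box 0 r ->
  (fun x => x + v) @^-1` A `<=` box 0 (`|r| + `|v.1| + `|v.2|).
Proof.
move=> Ar x /Ar /boxP; rewrite !subr0 => -[h1 h2]; apply/boxP; rewrite !subr0.
have := ler_norm r; have := normr_ge0 v.1; have := normr_ge0 v.2.
have : `|x.1| <= `|x.1 + v.1| + `|v.1|.
  by rewrite -{1}(addrK v.1 x.1) (le_trans (ler_normB _ _)).
have : `|x.2| <= `|x.2 + v.2| + `|v.2|.
  by rewrite -{1}(addrK v.2 x.2) (le_trans (ler_normB _ _)).
move: h1 h2 => /=; lra.
Qed.

Lemma Rintegral_translate (R : realType) (v : R * R) (A : set (R * R)) (f : R * R -> R) (r K : R) :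
  measurable (A : set (plane R)) -> A `<=` box 0 r -> measurable_fun [set: plane R] f ->
  (forall x, `|f x| <= K) ->
  \int[area]_(x in (fun x => x + v) @^-1` A) f (x + v) = \int[area]_(x in A) f x.
Proof.
move=> mA Ar mf fK; rewrite /Rintegral; congr fine.
have mA' := measurable_translate_preimage v mA.
pose h : {mfun plane R >-> plane R} :=
  HB.pack (fun x : plane R => (x : R * R) + v : plane R)
    (isMeasurableFun.Build _ _ _ _ _ (measurable_translate v)).
have <- : (\int[pushforward area h]_(x in A) (f x)%:E = \int[area]_(x in A) (f x)%:E)%E.
  by apply: eq_measure_integral => X mX _; apply: area_translate.
apply/esym; apply: (integral_pushforward (measurable_translate v) (f := EFin \o f)) => //.
  by apply/measurable_EFinP.
have Ar' := translate_preimage_box (v := v) Ar.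
apply: (bounded_integrable (f := fun x => f (x + v)) mA' Ar' _ (fun x _ => fK _)).
apply: measurable_funTS; apply: measurableT_comp => //.
exact: measurable_translate.
Qed.

Lemma normr_Rintegral_le (R : realType) (A : set (R * R)) (f : R * R -> R) (r K : R) :
  measurable (A : set (plane R)) -> A `<=` box 0 r -> measurable_fun (A : set (plane R)) f ->
  (forall x, A x -> `|f x| <= K) ->
  `|\int[area]_(x in A) f x| <= K * fine (area A).
Proof.
move=> mA Ar mf fK; have intf := bounded_integrable mA Ar mf fK.
apply: (le_trans (le_normr_Rintegral mA intf)).
rewrite -(Rintegral_cst _ mA); apply: le_Rintegral => //.
  exact: integrable_norm intf.
apply: (bounded_integrable (K := `|K|) mA Ar) => //; exact: measurable_cst.
Qed.

(* A function that changes sign under the half period [v] cancels on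
   [A `&` (A - v)], so that only the symmetric difference of [A] and [A - v]
   contributes to its integral. *)
Lemma Rintegral_half_period (R : realType) (v : R * R) (A : set (R * R))
    (f : R * R -> R) (r : R) :
  measurable (A : set (plane R)) -> A `<=` box 0 r -> measurable_fun [set: plane R] f ->
  (forall x, `|f x| <= 1) -> (forall x, f (x + v) = - f x) ->
  2 * `|\int[area]_(x in A) f x| <=
  fine (area (A `\` (fun x => x + v) @^-1` A)) +
  fine (area ((fun x => x + v) @^-1` A `\` A)).
Proof.
move=> mA Ar mf f1 fv; set A' := _ @^-1` A.
have mA' : measurable (A' : set (plane R)) by exact: measurable_translate_preimage.
have Ar' := translate_preimage_box (v := v) Ar.
have intA : area.-integrable A (EFin \o f).
  by apply: (bounded_integrable mA Ar (K := 1)) => //; exact: measurable_funTS.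
have intA' : area.-integrable A' (EFin \o f).
  by apply: (bounded_integrable mA' Ar' (K := 1)) => //; exact: measurable_funTS.
have E : \int[area]_(x in A) f x = - \int[area]_(x in A') f x.
  rewrite -(Rintegral_translate v mA Ar mf f1) -/A'.
  rewrite -mulN1r -RintegralZl//; apply: eq_Rintegral => x _.
  by rewrite fv mulN1r.
have split_int (B C : set (plane R)) : measurable B -> measurable C ->
    area.-integrable B (EFin \o f) ->
    \int[area]_(x in B) f x =
    \int[area]_(x in B `&` C) f x + \int[area]_(x in B `\` C) f x.
  move=> mB mC iB; rewrite -{1}(setUIDK B C) Rintegral_setU//.
  - exact: measurableI.
  - exact: measurableD.
  - by rewrite setUIDK.
  - by apply/disj_setPS => x [[_ ?] [_ ?]].
have h1 := split_int A A' mA mA' intA.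
have h2 := split_int A' A mA' mA intA'.
rewrite (setIC A' A) in h2.
have -> : 2 * `|\int[area]_(x in A) f x| =
    `|\int[area]_(x in A `\` A') f x - \int[area]_(x in A' `\` A) f x|.
  rewrite -[2]normr_nat -normrM; congr `|_|.
  by rewrite mulr2n mulrDl mul1r {1}E h1 h2; ring.
apply: (le_trans (ler_normB _ _)); apply: lerD.
  rewrite -[leRHS]mul1r; apply: (@normr_Rintegral_le _ _ _ r) => //.
  - exact: measurableD.
  - by move=> x [/Ar].
  - exact: measurable_funTS.
rewrite -[leRHS]mul1r; apply: (@normr_Rintegral_le _ _ _ (`|r| + `|v.1| + `|v.2|)) => //.
- exact: measurableD.
- by move=> x [/Ar'].
- exact: measurable_funTS.
Qed.

(** * Boundary layers of piecewise smooth domains *)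

(* [pr] is one of the two coordinate projections. *)
Lemma is_derive_proj (R : realType) (g : R -> R * R) (pr : R * R -> R) (s : R) :
  (forall (h : R) x y, pr (h *: (x - y)) = h * (pr x - pr y)) ->
  continuous pr -> derivable g s 1 -> is_derive s (1 : R) (pr \o g) (pr (g^`() s)).
Proof.
move=> plin pc dg.
have h : (fun h => h^-1 *: (((pr \o g) \o shift s) (h *: 1) - (pr \o g) s)) @ 0^'
    --> pr (g^`() s).
  rewrite derive1E (_ : (fun _ => _) =
    pr \o (fun h => h^-1 *: ((g \o shift s) (h *: 1) - g s))).
    exact: cvg_comp dg (pc _).
  by apply/funext => h; rewrite /= plin.
split; first by apply/cvg_ex; exists (pr (g^`() s)).
exact: (cvg_lim _ h).
Qed.

Lemma regular_arc_lipschitz (R : realType) (g : R -> R * R) : regular_arc g ->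
  exists2 K, 0 <= K & forall s t, 0 <= s <= 1 -> 0 <= t <= 1 ->
    `|(g s).1 - (g t).1| <= K * `|s - t| /\ `|(g s).2 - (g t).2| <= K * `|s - t|.
Proof.
move=> [dg cg _ _].
have comp (pr : R * R -> R)
    (plin : forall (h : R) x y, pr (h *: (x - y)) = h * (pr x - pr y)) (pc : continuous pr) :
    exists2 K, 0 <= K & forall s t, 0 <= s <= 1 -> 0 <= t <= 1 ->
    `|pr (g s) - pr (g t)| <= K * `|s - t|.
  have dpr s := is_derive_proj plin pc (dg s).
  have cont : continuous (fun s => `|pr (g^`() s)|).
    move=> s; have h := cvg_comp _ _ (cg s) (pc (g^`() s)).
    exact: cvg_norm h.
  have [c _ cmax] := EVT_max (@ler01 R) (continuous_subspaceT cont).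
  have cpr : continuous (pr \o g).
    by move=> s; apply/differentiable_continuous/derivable1_diffP; case: (dpr s).
  exists `|pr (g^`() c)| => //.
  have le_case s t : s <= t -> 0 <= s <= 1 -> 0 <= t <= 1 ->
      `|pr (g s) - pr (g t)| <= `|pr (g^`() c)| * `|s - t|.
    move=> st s01 t01; rewrite distrC (distrC s).
    have [x xst E] := MVT_segment st (fun x _ => dpr x)
      (continuous_subspaceT cpr).
    have E' : pr (g t) - pr (g s) = pr (g^`() x) * (t - s) by exact: E.
    rewrite E' normrM; apply: ler_wpM2r; first exact: normr_ge0.
    apply: cmax.
    case/andP: s01 t01 => s0 _ /andP[_ t1]; move: xst; rewrite !in_itv/=.
    by case/andP=> sx xt; rewrite (le_trans s0 sx) (le_trans xt t1).
  move=> s t s01 t01; have [st|/ltW ts] := leP s t; first exact: le_case.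
  by rewrite distrC (distrC s); exact: le_case.
have [K1 K10 h1] := comp fst (fun _ _ _ => erefl) (fun x => @cvg_fst _ _ (nbhs x.1) (nbhs x.2) _).
have [K2 K20 h2] := comp snd (fun _ _ _ => erefl) (fun x => @cvg_snd _ _ (nbhs x.1) (nbhs x.2) _).
exists (K1 + K2); first exact: addr_ge0.
move=> s t s01 t01; split.
  by apply: (le_trans (h1 _ _ s01 t01)); rewrite ler_wpM2r// lerDl.
by apply: (le_trans (h2 _ _ s01 t01)); rewrite ler_wpM2r// lerDr.
Qed.

Lemma segment_meets_boundary (R : realType) (A : set (R * R)) (p q : R * R) :
  A p -> ~ A q ->
  exists2 s : R, 0 <= s <= 1 &
    (closure A `\` A°) (p.1 + s * (q.1 - p.1), p.2 + s * (q.2 - p.2)).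
Proof.
move=> Ap Aq.
pose c (s : R) : R * R := (p.1 + s * (q.1 - p.1), p.2 + s * (q.2 - p.2)).
have cc : continuous c.
  have lin (u v : R) : continuous (fun s : R => u + s * v).
    by move=> s; apply: cvgD; [exact: cvg_cst|exact: mulrr_continuous].
  by move=> s; exact: (cvg_pair (lin p.1 (q.1 - p.1) s) (lin p.2 (q.2 - p.2) s)).
have c0 : c 0 = p by rewrite /c !mul0r !addr0; case: (p).
have c1 : c 1 = q by rewrite /c !mul1r !subrKC; case: (q).
pose S := [set s : R | 0 <= s <= 1 /\ A (c s)].
have S0 : S 0 by rewrite /S /= lexx ler01 c0.
have Sub : ubound S 1 by move=> s [/andP[]].
have hsS : has_sup S by split; [exists 0|exists 1].
have s0 : 0 <= sup S by apply: ub_le_sup => //; exists 1.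
have s1 : sup S <= 1 by apply: ge_sup => //; exists 0.
exists (sup S); first by rewrite s0 s1.
split.
  move=> B /cc nB.
  have [s [[_ As] Bs]] := closure_sup hsS.1 hsS.2 nB.
  by exists (c s).
move=> /cc nA; have nA' : \forall s \near sup S, A (c s) := nA.
have [s1'|s1'] := eqVneq (sup S) 1.
  by apply: Aq; have := nbhs_singleton nA'; rewrite s1' c1.
have sl1 : sup S < 1 by rewrite lt_neqAle s1'.
have : \forall s \near (sup S)^'+, False.
  near=> s.
  have : S s.
    split; last by near: s; exact: cvg_within.
    by apply/andP; split; [apply: (le_trans s0)|]; near: s; [exact: nbhs_right_ge|exact: nbhs_right_le].
  have ss : sup S < s by near: s; exact: nbhs_right_gt.
  move=> /(sup_upper_bound hsS) h; move: ss; rewrite ltNge.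
  by rewrite h.
by move/filter_ex => [].
Unshelve. all: by end_near. Qed.

Lemma area_cover (R : realType) (D : set (R * R)) (pts : seq (R * R)) (r : R) :
  0 <= r -> measurable (D : set (plane R)) ->
  (forall x, D x -> exists2 p, p \in pts & box p r x) ->
  fine (area D) <= (size pts)%:R * (4 * r ^+ 2).
Proof.
move=> r0; suff h : forall D : set (R * R), measurable (D : set (plane R)) ->
  (forall x, D x -> exists2 p, p \in pts & box p r x) ->
  (area D <= ((size pts)%:R * (4 * r ^+ 2))%:E)%E.
  move=> mD Dp; have hD := h D mD Dp.
  by rewrite -lee_fin fineK// ge0_fin_numE// (le_lt_trans hD)// ltry.
elim: pts {D} => [|p pts IH] D mD Dp.
  have -> : D = set0 by apply/seteqP; split => x // /Dp[].
  by rewrite mul0r (_ : area set0 = 0%E)//; exact: measure0.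
have mb : measurable (box p r : set (plane R)) by exact: measurable_box.
have -> : area D = (area (D `\` box p r) + area (D `&` box p r))%E.
  exact: measureDI.
rewrite [size _]/= -addn1 natrD mulrDl mul1r EFinD; apply: leeD.
  apply: IH; first exact: measurableD.
  move=> x [/Dp[q]]; rewrite inE => /predU1P[->|qp] bx nb //.
  by exists q.
rewrite -(area_box p r0); apply: le_measure; rewrite ?inE//; first exact: measurableI.
Qed.

Lemma near_grid (R : realType) (n : nat) (s : R) : (0 < n)%N -> 0 <= s <= 1 ->
  exists2 m, (m <= n)%N & `|s - m%:R / n%:R| <= n%:R^-1.
Proof.
move=> n0 /andP[s0 s1]; have n0' : (0 : R) < n%:R by rewrite ltr0n.
have sn0 : 0 <= s * n%:R by rewrite mulr_ge0// ltW.
exists (Num.truncn (s * n%:R)).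
  have := truncn_itv sn0 => /andP[h _].
  by rewrite -(ler_nat R) (le_trans h)// ler_piMl// ltW.
have /andP[h1 h2] := truncn_itv sn0.
rewrite -(ler_pM2r n0') mulVf ?gt_eqF// -[X in _ * X](gtr0_norm n0') -normrM.
rewrite mulrBl divfK ?gt_eqF// ger0_norm ?subr_ge0//.
by rewrite lerBlDr addrC natr1 ltW.
Qed.

Lemma curve_cover (R : realType) (S : set (R * R)) : piecewise_smooth_curve S ->
  exists (N : nat) (K : R), 0 <= K /\ forall n, (0 < n)%N ->
    exists pts : seq (R * R), (size pts <= N * n.+1)%N /\
      forall q, S q -> exists2 p, p \in pts & box p (K / n%:R) q.
Proof.
move=> [N [g [garc _ ->]]].
have [K hK] : exists K : 'I_N -> R, forall i, 0 <= K i /\ forall s t, 0 <= s <= 1 -> 0 <= t <= 1 ->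
    `|(g i s).1 - (g i t).1| <= K i * `|s - t| /\ `|(g i s).2 - (g i t).2| <= K i * `|s - t|.
  have h i : exists K, 0 <= K /\ forall s t, 0 <= s <= 1 -> 0 <= t <= 1 ->
    `|(g i s).1 - (g i t).1| <= K * `|s - t| /\ `|(g i s).2 - (g i t).2| <= K * `|s - t|.
    by have [K K0 hK] := regular_arc_lipschitz (garc i); exists K.
  by have [K hK] := choice h; exists K.
exists N, (\sum_i K i); split; first by apply: sumr_ge0 => i _; case: (hK i).
move=> n n0; have n0' : (0 : R) < n%:R by rewrite ltr0n.
exists [seq g i (m%:R / n%:R) | i <- enum 'I_N, m <- iota 0 n.+1]; split.
  by rewrite size_allpairs size_enum_ord size_iota.
move=> q [i _ [s s01' <-]].
have s01 : 0 <= s <= 1 by move: s01'; rewrite /= in_itv.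
have [m mn hm] := near_grid n0 s01.
exists (g i (m%:R / n%:R)).
  apply/allpairsP; exists (i, m); split => //; first by rewrite mem_enum.
  by rewrite [_.2]/= mem_iota add0n ltnS.
have m01 : 0 <= (m%:R / n%:R : R) <= 1.
  by rewrite divr_ge0//= ler_pdivrMr// mul1r ler_nat.
have [Ki0 /(_ _ _ s01 m01)[h1 h2]] := hK i.
have KK : K i * `|s - m%:R / n%:R| <= (\sum_i K i) / n%:R.
  apply: ler_pM => //; rewrite (bigD1 i)//= lerDl sumr_ge0// => j _.
  by case: (hK j).
by apply/boxP; split; [exact: le_trans h1 KK|exact: le_trans h2 KK].
Qed.

Lemma scaled_arrayP (R : realType) (a : R) (A : set (R * R)) (x : R * R) : 0 < a ->
  scaled_array a A x <-> A (x.1 / a, x.2 / a).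
Proof.
move=> a0; have an0 : a != 0 by rewrite gt_eqF.
split=> [[p Ap <-]|Ax].
  by rewrite /= !(mulrC a) !mulfK//; case: p Ap.
by exists (x.1 / a, x.2 / a) => //=; rewrite !(mulrC a) !divfK//; case: x Ax.
Qed.

Lemma measurable_scaled_array (R : realType) (a : R) (A : set (R * R)) : 0 < a ->
  measurable (A : set (plane R)) -> measurable (scaled_array a A : set (plane R)).
Proof.
move=> a0 mA.
rewrite (_ : scaled_array a A = (fun x : plane R => ((x.1 : R) / a, (x.2 : R) / a) : plane R) @^-1` A).
  rewrite -[X in measurable X]setTI.
  have m : measurable_fun [set: plane R]
      (fun x : plane R => ((x.1 : R) / a, (x.2 : R) / a) : plane R).
    apply: measurable_fun_pair.
      apply: (@measurable_funM _ (plane R) R setT fst (cst a^-1)).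
        exact: measurable_fst.
      exact: measurable_cst.
    apply: (@measurable_funM _ (plane R) R setT snd (cst a^-1)).
      exact: measurable_snd.
    exact: measurable_cst.
  exact: m.
by apply/seteqP; split => x; rewrite scaled_arrayP.
Qed.

Lemma bounded_set_box (R : realType) (A : set (R * R)) : bounded_set A ->
  exists2 r, 0 <= r & A `<=` box 0 r.
Proof.
move=> [M [_ hM]]; exists (`|M| + 1); first by rewrite addr_ge0.
move=> x Ax; have h : `|x| <= `|M| + 1.
  by apply: hM => //; rewrite (le_lt_trans (ler_norm M))// ltrDl.
have h1 : `|x.1| <= `|x| by rewrite [leRHS]prod_normE le_max lexx.
have h2 : `|x.2| <= `|x| by rewrite [leRHS]prod_normE le_max lexx orbT.
by apply/boxP; rewrite !subr0; split; [exact: le_trans h1 h|exact: le_trans h2 h].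
Qed.

Lemma scaled_array_box (R : realType) (a r : R) (A : set (R * R)) : 0 < a ->
  A `<=` box 0 r -> scaled_array a A `<=` box 0 (a * r).
Proof.
move=> a0 Ar x /(scaled_arrayP _ _ a0) /Ar /boxP /=; rewrite !subr0 => -[h1 h2].
apply/boxP; rewrite !subr0; move: h1 h2.
by rewrite !normrM normfV (gtr0_norm a0) !ler_pdivrMr// !(mulrC r).
Qed.

Lemma box_segment (R : realType) (p q : R * R) (s w : R) : 0 <= s <= 1 ->
  `|q.1 - p.1| <= w -> `|q.2 - p.2| <= w ->
  box p w (p.1 + s * (q.1 - p.1), p.2 + s * (q.2 - p.2)).
Proof.
move=> /andP[s0 s1] h1 h2; apply/boxP; rewrite /= !(addrC _ (s * _)) !addrK !normrM.
by rewrite (ger0_norm s0); rewrite -(mul1r w); split; apply: ler_pM.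
Qed.

Lemma boundary_near (R : realType) (A : set (R * R)) (p q : R * R) (w : R) :
  `|q.1 - p.1| <= w -> `|q.2 - p.2| <= w ->
  (A p /\ ~ A q) \/ (~ A p /\ A q) ->
  exists2 z, (closure A `\` A°) z & box p w z.
Proof.
move=> h1 h2 [[Ap Aq]|[Ap Aq]].
  have [s s01 hs] := segment_meets_boundary Ap Aq.
  by eexists; [exact: hs|exact: box_segment].
have [s s01 hs] := segment_meets_boundary Aq Ap.
eexists; first exact: hs.
rewrite (_ : (_, _) = (p.1 + (1 - s) * (q.1 - p.1), p.2 + (1 - s) * (q.2 - p.2))).
  by apply: box_segment => //; rewrite subr_ge0 gerBl; case/andP: s01 => -> ->.
by congr pair; ring.
Qed.

(* The boundary is covered by [O(a / w)] squares of side [O(w)]. *)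
Lemma boundary_layer_area (R : realType) (A : set (R * R)) :
  bounded_piecewise_smooth_domain A ->
  exists2 C, 0 <= C & forall (a w : R) (v : R * R) (D : set (R * R)),
    0 < a -> 0 < w -> `|v.1| <= w -> `|v.2| <= w ->
    measurable (D : set (plane R)) ->
    (forall x, D x -> (scaled_array a A x /\ ~ scaled_array a A (x + v)) \/
                      (~ scaled_array a A x /\ scaled_array a A (x + v))) ->
    fine (area D) <= C * a * w.
Proof.
move=> [/bounded_set_box[r r0 Ar] _ _ _ /curve_cover[N [K [K0 cover]]]].
exists (12 * N%:R * (1 + K) ^+ 2 + 8 * r ^+ 2).
  by rewrite addr_ge0// !mulr_ge0// ?exprn_ge0// addr_ge0.
move=> a w v D a0 w0 v1 v2 mD DA.
have [aw|wa] := ltP a w.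
  have h := @area_cover _ D [:: 0; - v] (a * r) (mulr_ge0 (ltW a0) r0) mD.
  apply: (le_trans (h _)).
    move=> x /DA[[Bx _]|[_ Bx]].
      by exists 0; [rewrite inE eqxx|exact: scaled_array_box Bx].
    exists (- v); first by rewrite !inE eqxx orbT.
    have := scaled_array_box a0 Ar Bx => /boxP; rewrite !subr0 => hb.
    by apply/boxP; rewrite /= !opprK.
  apply: (@le_trans _ _ (8 * r ^+ 2 * a * w)).
    rewrite (_ : (size _)%:R * _ = 8 * r ^+ 2 * a * a); last by rewrite /=; ring.
    by rewrite ler_wpM2l ?(ltW aw)// !mulr_ge0// ?exprn_ge0// ltW.
  rewrite -!(mulrA _ a w); apply: ler_wpM2r; rewrite ?mulr_ge0 ?(ltW a0) ?(ltW w0)// lerDr.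
  by rewrite !mulr_ge0// ?exprn_ge0// addr_ge0.
have aw1 : 1 <= a / w by rewrite ler_pdivlMr// mul1r.
have aw0 : 0 <= a / w by rewrite (le_trans _ aw1).
pose n := (Num.truncn (a / w)).+1.
have /andP[n1 n2] := truncn_itv aw0.
have [pts [szpts hpts]] := cover n isT.
have n0 : (0 : R) < n%:R by rewrite ltr0n.
have rr0 : 0 <= (1 + K) * w by rewrite mulr_ge0// ?addr_ge0// ltW.
have := @area_cover _ D [seq (a * p.1, a * p.2) | p <- pts] _ rr0 mD.
move=> h; apply: (le_trans (h _)).
  move=> x /DA xD.
  have [z zA zx] : exists2 z, (closure A `\` A°) z & box (x.1 / a, x.2 / a) (w / a) z.
    apply: (@boundary_near _ _ _ ((x + v).1 / a, (x + v).2 / a)).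
    - by rewrite /= -mulrBl addrC addKr normrM normfV (gtr0_norm a0) ler_pM2r ?invr_gt0.
    - by rewrite /= -mulrBl addrC addKr normrM normfV (gtr0_norm a0) ler_pM2r ?invr_gt0.
    - by move: xD; rewrite !scaled_arrayP.
  have [p pin pz] := hpts z zA.
  exists (a * p.1, a * p.2); first by apply/mapP; exists p.
  move: pz zx => /boxP[pz1 pz2] /boxP[/= zx1 zx2].
  have an0 : a != 0 by rewrite gt_eqF.
  have comp (xi zi pi : R) : `|zi - xi / a| <= w / a -> `|zi - pi| <= K / n%:R ->
      `|xi - a * pi| <= (1 + K) * w.
    move=> e1 e2; rewrite (_ : xi - a * pi = a * ((zi - pi) - (zi - xi / a))); last by field.
    rewrite normrM (gtr0_norm a0).
    apply: (@le_trans _ _ (a * (K / n%:R + w / a))).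
      by rewrite ler_pM2l// (le_trans (ler_normB _ _))// lerD.
    rewrite mulrDr (mulrC w) mulVKf// mulrDl mul1r [leRHS]addrC lerD2r.
    rewrite mulrCA ler_wpM2l// ler_pdivrMr// mulrC -ler_pdivrMr//.
    exact: ltW.
  by apply/boxP; split; [exact: comp zx1 pz1|exact: comp zx2 pz2].
rewrite size_map.
have szle : (size pts)%:R <= N%:R * (3 * (a / w)).
  apply: (@le_trans _ _ (N * n.+1)%:R); first by rewrite ler_nat.
  rewrite natrM ler_wpM2l// /n -[_.+2]addn2 natrD.
  rewrite (_ : 3 * (a / w) = a / w + 2 * (a / w)); last by ring.
  by rewrite lerD// ler_peMr.
apply: (@le_trans _ _ (N%:R * (3 * (a / w)) * (4 * ((1 + K) * w) ^+ 2))).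
  by rewrite ler_wpM2r// mulr_ge0// exprn_ge0.
rewrite (_ : _ * (4 * _) = 12 * N%:R * (1 + K) ^+ 2 * a * w); last first.
  by field; rewrite gt_eqF.
rewrite -!(mulrA _ a w); apply: ler_wpM2r; rewrite ?mulr_ge0 ?(ltW a0) ?(ltW w0)// lerDl.
by rewrite mulr_ge0// exprn_ge0.
Qed.

(** * Oscillatory integrals *)

Lemma measurable_phase (R : realType) (xi : R * R) (psi : R) :
  measurable_fun [set: plane R] (fun x => psi + (xi.1 * x.1 + xi.2 * x.2)).
Proof.
have m1 : measurable_fun [set: plane R] (fun x : plane R => x.1 : R) by exact: measurable_fst.
have m2 : measurable_fun [set: plane R] (fun x : plane R => x.2 : R) by exact: measurable_snd.
apply: (@measurable_funD _ (plane R) R setT (cst psi)); first exact: measurable_cst.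
by apply: (@measurable_funD _ (plane R) R setT);
  apply: (@measurable_funM _ (plane R) R setT (cst _)) => //; exact: measurable_cst.
Qed.

Lemma measurable_cos (R : realType) : measurable_fun [set: R] (@cos R).
Proof. by apply: continuous_measurable_fun; exact: continuous_cos. Qed.

Lemma measurable_sin (R : realType) : measurable_fun [set: R] (@sin R).
Proof. by apply: continuous_measurable_fun; exact: continuous_sin. Qed.

Lemma measurable_cos_phase (R : realType) (xi : R * R) (psi : R) :
  measurable_fun [set: plane R] (fun x => cos (psi + (xi.1 * x.1 + xi.2 * x.2))).
Proof.
exact: (measurableT_comp (@measurable_cos R) (measurable_phase xi psi)).
Qed.

Lemma enorm2_sqr (R : realType) (x : R * R) : enorm2 x ^+ 2 = x.1 ^+ 2 + x.2 ^+ 2.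
Proof. by rewrite sqr_sqrtr// addr_ge0 ?sqr_ge0. Qed.

Lemma enorm2_ge1 (R : realType) (x : R * R) : `|x.1| <= enorm2 x.
Proof. by rewrite -sqrtr_sqr ler_wsqrtr// lerDl sqr_ge0. Qed.

Lemma enorm2_ge2 (R : realType) (x : R * R) : `|x.2| <= enorm2 x.
Proof. by rewrite -sqrtr_sqr ler_wsqrtr// lerDr sqr_ge0. Qed.

Lemma oscillatory_integral (R : realType) (A : set (R * R)) :
  bounded_piecewise_smooth_domain A ->
  exists2 C, 0 <= C & forall (a : R) (xi : R * R) (psi : R),
    0 < a -> 0 < enorm2 xi ->
    `|\int[area]_(x in scaled_array a A) cos (psi + (xi.1 * x.1 + xi.2 * x.2))|
    <= C * a / enorm2 xi.
Proof.
move=> domA; have [C C0 hC] := boundary_layer_area domA.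
case: domA => /bounded_set_box[r r0 Ar] mA _ _ _.
exists (C * pi); first by rewrite mulr_ge0// pi_ge0.
move=> a xi psi a0 xi0.
set B := scaled_array a A.
set f := fun x : R * R => _.
pose v : R * R := (pi * xi.1 / enorm2 xi ^+ 2, pi * xi.2 / enorm2 xi ^+ 2).
have mB : measurable (B : set (plane R)) by exact: measurable_scaled_array.
have fv x : f (x + v) = - f x.
  rewrite /f -cosDpi; congr cos; rewrite /=.
  have e : pi = (xi.1 ^+ 2 + xi.2 ^+ 2) / enorm2 xi ^+ 2 * pi :> R.
    by rewrite -enorm2_sqr divff ?mul1r// expf_neq0// gt_eqF.
  by rewrite [X in _ = _ + X]e; field; rewrite gt_eqF.
have w0 : 0 < pi / enorm2 xi by rewrite divr_gt0// pi_gt0.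
have vw (u : R) : `|u| <= enorm2 xi -> `|pi * u / enorm2 xi ^+ 2| <= pi / enorm2 xi.
  move=> hu; rewrite -mulrA normrM (ger0_norm (pi_ge0 R)) ler_wpM2l ?pi_ge0//.
  rewrite normrM normfV (ger0_norm (sqr_ge0 _)) ler_pdivrMr ?exprn_gt0//.
  by rewrite expr2 mulKf ?gt_eqF.
have mv : measurable ((fun x => x + v) @^-1` B : set (plane R)).
  exact: measurable_translate_preimage.
have h := Rintegral_half_period mB (scaled_array_box a0 Ar)
  (measurable_cos_phase xi psi) (fun x => cos_max _) fv.
have h1 : fine (area (B `\` (fun x => x + v) @^-1` B)) <= C * a * (pi / enorm2 xi).
  apply: (hC _ _ v) => //; [exact: vw (enorm2_ge1 xi)|exact: vw (enorm2_ge2 xi)| |].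
    exact: measurableD.
  by move=> x [Bx nBx]; left.
have h2 : fine (area ((fun x => x + v) @^-1` B `\` B)) <= C * a * (pi / enorm2 xi).
  apply: (hC _ _ v) => //; [exact: vw (enorm2_ge1 xi)|exact: vw (enorm2_ge2 xi)| |].
    exact: measurableD.
  by move=> x [Bx nBx]; right.
rewrite (_ : C * pi * a / _ = C * a * (pi / enorm2 xi)); last by ring.
rewrite -(ler_pM2l (x := 2))//; apply: (le_trans h).
by rewrite [leRHS]mulrDl mul1r lerD.
Qed.

(** * Fraunhofer approximation of the dyadic Green function *)

Lemma normc_real (R : realType) (x : R) : Normc.normc x%:C = `|x|.
Proof. by rewrite /Normc.normc /= expr0n addr0 sqrtr_sqr. Qed.

Lemma normc_conj (R : realType) (z : R[i]) : Normc.normc (conjc z) = Normc.normc z.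
Proof. by case: z => x y; rewrite /Normc.normc /= sqrrN. Qed.

Lemma normc_ge0 (R : realType) (z : R[i]) : 0 <= Normc.normc z.
Proof. by case: z => x y; exact: sqrtr_ge0. Qed.

Lemma normcD (R : realType) (z w : R[i]) :
  Normc.normc (z + w) <= Normc.normc z + Normc.normc w.
Proof. exact: le_normcD. Qed.

Lemma normcB (R : realType) (z w : R[i]) :
  Normc.normc (z - w) <= Normc.normc z + Normc.normc w.
Proof. by apply: (le_trans (le_normcD _ _)); rewrite normcN. Qed.

Lemma normr_Re_le (R : realType) (z : R[i]) : `|complex.Re z| <= Normc.normc z.
Proof.
by case: z => x y; rewrite /Normc.normc /= -sqrtr_sqr ler_wsqrtr// lerDl sqr_ge0.
Qed.

Lemma normr_Im_le (R : realType) (z : R[i]) : `|complex.Im z| <= Normc.normc z.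
Proof.
by case: z => x y; rewrite /Normc.normc /= -sqrtr_sqr ler_wsqrtr// lerDr sqr_ge0.
Qed.

Lemma normc_le_add (R : realType) (z : R[i]) :
  Normc.normc z <= `|complex.Re z| + `|complex.Im z|.
Proof.
case: z => x y; rewrite /Normc.normc /=.
rewrite -[leRHS]ger0_norm ?addr_ge0// -[leRHS]sqrtr_sqr ler_wsqrtr//.
by rewrite sqrrD !real_normK ?num_real// lerD2r lerDl mulrn_wge0// mulr_ge0.
Qed.

Lemma normc_expi (R : realType) (t : R) : Normc.normc (expi t) = 1.
Proof. by rewrite /Normc.normc /expi cos2Dsin2 sqrtr1. Qed.

Lemma cos_lipschitz (R : realType) (s t : R) : `|cos s - cos t| <= `|s - t|.
Proof.
wlog st : s t / s <= t => [h|].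
  by have [/h//|/ltW/h] := leP s t; rewrite distrC (distrC t).
rewrite distrC (distrC s).
have [c _ ->] := MVT_segment st (fun x _ => is_derive_cos x) (continuous_subspaceT (@continuous_cos R)).
by rewrite normrM normrN ler_piMl// sin_max.
Qed.

Lemma sin_lipschitz (R : realType) (s t : R) : `|sin s - sin t| <= `|s - t|.
Proof.
wlog st : s t / s <= t => [h|].
  by have [/h//|/ltW/h] := leP s t; rewrite distrC (distrC t).
rewrite distrC (distrC s).
have [c _ ->] := MVT_segment st (fun x _ => is_derive_sin x) (continuous_subspaceT (@continuous_sin R)).
by rewrite normrM ler_piMl// cos_max.
Qed.

Lemma normc_expiB (R : realType) (s t : R) :
  Normc.normc (expi s - expi t) <= 2 * `|s - t|.
Proof.
apply: (le_trans (normc_le_add _)); rewrite /expi /= mulr2n mulrDl mul1r.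
by rewrite lerD ?cos_lipschitz ?sin_lipschitz.
Qed.

Lemma expi_conjM (R : realType) (s t : R) : conjc (expi s) * expi t = expi (t - s).
Proof.
rewrite /expi cosB sinB; apply/eqP; rewrite eq_complex /=; apply/andP; split; apply/eqP; ring.
Qed.

Lemma dist_bounds (R : realType) (u1 u2 z c L r : R) :
  0 < c -> 16 * c <= L -> `|u1| <= 2 * c -> `|u2| <= 2 * c -> `|z - L| <= c ->
  0 < r -> r ^+ 2 = u1 ^+ 2 + u2 ^+ 2 + z ^+ 2 ->
  [/\ z <= r, (r - z) * L <= 8 * c ^+ 2, `|r - L| <= 2 * c & 15 * L <= 16 * z].
Proof.
move=> c0 cL hu1 hu2 hz r0 r2.
have {hz} /andP[z1 z2] : L - c <= z <= L + c by rewrite -ler_distl.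
have s1 : u1 ^+ 2 <= 4 * c ^+ 2.
  rewrite -(ler_sqr (x := `|u1|)) ?nnegrE// in hu1; last by rewrite mulr_ge0// ltW.
  by rewrite real_normK ?num_real// exprMn in hu1; apply: (le_trans hu1); rewrite ler_wpM2r ?sqr_ge0//; lra.
have s2 : u2 ^+ 2 <= 4 * c ^+ 2.
  rewrite -(ler_sqr (x := `|u2|)) ?nnegrE// in hu2; last by rewrite mulr_ge0// ltW.
  by rewrite real_normK ?num_real// exprMn in hu2; apply: (le_trans hu2); rewrite ler_wpM2r ?sqr_ge0//; lra.
clear hu1 hu2.
have zr : z <= r.
  rewrite -(ler_sqr (x := z)) ?nnegrE; [|lra|lra].
  by rewrite r2 lerDr addr_ge0 ?sqr_ge0.
have h : (r - z) * L <= 8 * c ^+ 2.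
  apply: (@le_trans _ _ ((r - z) * (r + z))); last first.
    by rewrite -subr_sqr r2; lra.
  by rewrite ler_wpM2l ?subr_ge0//; lra.
have rz : r - z <= c.
  rewrite -(ler_pM2r (x := L)); last by lra.
  apply: (le_trans h); rewrite expr2 mulrA mulrC ler_pM2l//; lra.
split => //; [rewrite ler_norml; apply/andP; split; lra|lra].
Qed.

Lemma phase_bound (R : realType) (r r' z n c L : R) :
  0 < c -> 0 < L -> 15 * L <= 16 * z -> z <= r -> z <= r' ->
  (r - z) * L <= 8 * c ^+ 2 -> (r' - z) * L <= 8 * c ^+ 2 ->
  n = r' ^+ 2 - r ^+ 2 -> `|n| <= 16 * c ^+ 2 ->
  `|(r' - r) - n / (2 * z)| <= 256 * c ^+ 4 / L ^+ 3.
Proof.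
move=> c0 L0 zL zr zr' h h' En hn.
have z0 : 0 < z by lra.
have rr : 0 < r + r' by lra.
have -> : (r' - r) - n / (2 * z) = n * (2 * z - (r + r')) / ((r + r') * (2 * z)).
  by rewrite En; field; rewrite !gt_eqF.
rewrite normrM normfV normrM (gtr0_norm (mulr_gt0 rr _)); last by lra.
rewrite ler_pdivrMr; last by rewrite mulr_gt0//; lra.
rewrite mulrAC ler_pdivlMr ?exprn_gt0//.
rewrite (_ : L ^+ 3 = L * (L * L)); last by ring.
rewrite -mulrA (mulrA `|2 * z - _|).
have -> : `|2 * z - (r + r')| = (r - z) + (r' - z) by rewrite ler0_norm; lra.
rewrite (_ : 256 * c ^+ 4 * _ = (16 * c ^+ 2) * ((16 * c ^+ 2) * ((r + r') * (2 * z)))); last by ring.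
apply: ler_pM => //.
  rewrite !mulr_ge0//; lra.
apply: ler_pM; [rewrite mulr_ge0//; lra|rewrite mulr_ge0//; lra|lra|].
by apply: ler_pM; lra.
Qed.

Lemma amplitude_bound (R : realType) (r r' c L : R) :
  0 < c -> 16 * c <= L -> `|r - L| <= 2 * c -> `|r' - L| <= 2 * c ->
  `|(r * r')^-1 - (L ^+ 2)^-1| <= 24 * c / L ^+ 3.
Proof.
move=> c0 cL h h'.
have {h} /andP[r1 r2] : L - 2 * c <= r <= L + 2 * c by rewrite -ler_distl.
have {h'} /andP[r1' r2'] : L - 2 * c <= r' <= L + 2 * c by rewrite -ler_distl.
have L0 : 0 < L by lra.
have rr0 : 0 < r * r' by rewrite mulr_gt0//; lra.
have -> : (r * r')^-1 - (L ^+ 2)^-1 = (L * (L - r') + r' * (L - r)) / (r * r' * L ^+ 2).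
  by field; rewrite !gt_eqF//; lra.
have ge : L ^+ 2 <= 4 * (r * r').
  rewrite (_ : 4 * (r * r') = (2 * r) * (2 * r')); last by ring.
  by rewrite expr2 ler_pM//; lra.
rewrite normrM normfV (gtr0_norm (mulr_gt0 rr0 (exprn_gt0 2 L0))).
have den0 : 0 < r * r' * L ^+ 2 by rewrite mulr_gt0// exprn_gt0.
rewrite (ler_pdivrMr _ _ den0).
have num : `|L * (L - r') + r' * (L - r)| <= 6 * c * L.
  apply: (le_trans (ler_normD _ _)); rewrite !normrM (gtr0_norm L0).
  have r'0 : 0 < r' by lra.
  rewrite (gtr0_norm r'0).
  apply: (@le_trans _ _ (L * (2 * c) + (2 * L) * (2 * c))); last by lra.
  apply: lerD.
    by rewrite ler_pM2l// ler_norml; apply/andP; split; lra.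
  apply: ler_pM; [lra|exact: normr_ge0|lra|].
  by rewrite ler_norml; apply/andP; split; lra.
apply: (le_trans num).
rewrite (_ : 24 * c / L ^+ 3 * _ = 6 * c * (4 * (r * r')) / L); last first.
  by field; rewrite gt_eqF.
by rewrite -(mulrA (6 * c)) ler_pM2l ?mulr_gt0// ler_pdivlMr// -expr2.
Qed.

Definition green_amplitude (R : realType) (k : R) (x y : 'cV[R]_3) : 'M[R[i]]_3 :=
  let rv := x - y in
  let r := enorm3 rv in
  (1 + mfac (k * r)) *: 1%:M -
  ((1 + 3 * mfac (k * r)) / (r ^+ 2)%:C) *:
    map_mx (fun u : R => u%:C) (rv *m rv^T).

Definition transverse (R : realType) : 'M[R[i]]_3 :=
  \matrix_(i, j) ((i == j) && (i < 2)%N)%:R%:C.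

Lemma dyadic_greenE (R : realType) (k : R) (x y : 'cV[R]_3) :
  dyadic_green k x y = green k x y *: green_amplitude k x y.
Proof. by []. Qed.

Lemma enorm3E (R : realType) (v : 'cV[R]_3) : enorm3 v ^+ 2 = \sum_i v i 0 ^+ 2.
Proof. by rewrite sqr_sqrtr// sumr_ge0// => i _; rewrite sqr_ge0. Qed.

Lemma normc_mfac (R : realType) (s : R) : 1 <= s -> Normc.normc (mfac s) <= 2 / s.
Proof.
move=> s1; have s0 : 0 < s by rewrite (lt_le_trans _ s1).
rewrite /mfac Normc.normcM Normc.normcV normc_real (ger0_norm (sqr_ge0 _)).
rewrite ler_pdivrMr ?exprn_gt0//.
apply: (le_trans (normcB _ _)); rewrite Normc.normcM normc_real Normc.normc1.
rewrite [Normc.normc 'i]/= expr0n expr1n add0r sqrtr1 mulr1 (gtr0_norm s0).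
by rewrite expr2 mulrA divfK ?gt_eqF//; lra.
Qed.

Lemma green_amplitudeE (R : realType) (k : R) (x y : 'cV[R]_3) (t : 'I_3 -> R) i j :
  (forall i, t i = (x - y) i 0 / enorm3 (x - y)) ->
  green_amplitude k x y i j =
  ((i == j)%:R - t i * t j)%:C +
  mfac (k * enorm3 (x - y)) * ((i == j)%:R - 3 * (t i * t j))%:C.
Proof.
move=> tE; rewrite !tE.
rewrite /green_amplitude; move: (x - y) => rv; set r := enorm3 rv; set m := mfac _.
rewrite !mxE big_ord1 [rv^T _ j]mxE /= [ord0]ord1.
rewrite !rmorphB !rmorphM/= !rmorph_nat !fmorphV/= invfM; ring.
Qed.

Lemma ord3P (i : 'I_3) : [\/ i = 0, i = 1 | i = 2%:R].
Proof.
case: i => [[|[|[|//]]] p]; [apply: Or31|apply: Or32|apply: Or33]; exact: val_inj.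
Qed.

Lemma sum3 (V : zmodType) (F : 'I_3 -> V) : \sum_i F i = F 0 + F 1 + F 2%:R.
Proof.
rewrite !big_ord_recl big_ord0 addr0 addrA.
by congr (_ + _ + _); congr F; exact: val_inj.
Qed.

Lemma transverse_dev (R : realType) (t : 'I_3 -> R) (b : R) i j :
  b <= 1 / 4 -> `|t 0| <= b -> `|t 1| <= b -> t 0 ^+ 2 + t 1 ^+ 2 + t 2%:R ^+ 2 = 1 ->
  `|(i == j)%:R - t i * t j - ((i == j) && (i < 2)%N)%:R| <= b /\ `|t i * t j| <= 1.
Proof.
move=> b4 h0 h1 ht.
have b0 : 0 <= b by rewrite (le_trans _ h0).
have h2 : `|t 2%:R| <= 1.
  by rewrite -(expr_le1 (n := 2))// real_normK ?num_real// -ht lerDr addr_ge0 ?sqr_ge0.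
have s0 : t 0 ^+ 2 <= b / 4.
  by rewrite -[_ ^+ 2]real_normK ?num_real// expr2 ler_pM//; lra.
have s1 : t 1 ^+ 2 <= b / 4.
  by rewrite -[_ ^+ 2]real_normK ?num_real// expr2 ler_pM//; lra.
have pb (u v : R) : `|u| <= b -> `|v| <= 1 -> `|u * v| <= b /\ `|v * u| <= b.
  by move=> hu hv; rewrite (mulrC v) normrM -[X in _ <= X]mulr1; split; apply: ler_pM.
have le1 (u : R) : `|u| <= b -> `|u| <= 1 by move=> h; apply: (le_trans h); lra.
have g0 := le1 _ h0; have g1 := le1 _ h1.
split; last first.
  rewrite normrM -[leRHS]mulr1.
  by case: (ord3P i) => ->; case: (ord3P j) => ->; apply: ler_pM.
case: (ord3P i) => ->; case: (ord3P j) => -> /=;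
  rewrite ?subr0 ?sub0r ?opprK ?normrN.
- rewrite (_ : 1 - _ - 1 = - (t 0 * t 0)); last by ring.
  by rewrite normrN; case: (pb _ _ h0 g0).
- by case: (pb _ _ h0 g1).
- by case: (pb _ _ h0 h2).
- by case: (pb _ _ h1 g0).
- rewrite (_ : 1 - _ - 1 = - (t 1 * t 1)); last by ring.
  by rewrite normrN; case: (pb _ _ h1 g1).
- by case: (pb _ _ h1 h2).
- by case: (pb _ _ h0 h2).
- by case: (pb _ _ h1 h2).
rewrite (_ : 1 - _ = t 0 ^+ 2 + t 1 ^+ 2); last by rewrite -ht; ring.
by rewrite ger0_norm ?addr_ge0 ?sqr_ge0//; lra.
Qed.

Lemma green_amplitude_near (R : realType) (k : R) (x y : 'cV[R]_3) (b : R) :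
  b <= 1 / 4 -> 1 <= k * enorm3 (x - y) -> 2 / (k * enorm3 (x - y)) <= b ->
  `|(x - y) 0 0| / enorm3 (x - y) <= b -> `|(x - y) 1 0| / enorm3 (x - y) <= b ->
  0 < enorm3 (x - y) ->
  forall i j, Normc.normc (green_amplitude k x y i j - transverse R i j) <= 5 * b.
Proof.
move=> b4 kr kr' h0 h1 r0 i j.
set r := enorm3 (x - y) in kr kr' h0 h1 r0 *.
pose t := fun i => (x - y) i 0 / r.
have ht : t 0 ^+ 2 + t 1 ^+ 2 + t 2%:R ^+ 2 = 1.
  rewrite /t !expr_div_n -!mulrDl.
  have -> : (x - y) 0 0 ^+ 2 + (x - y) 1 0 ^+ 2 + (x - y) 2%:R 0 ^+ 2 = r ^+ 2.
    by rewrite enorm3E (sum3 (fun i => (x - y) i 0 ^+ 2)).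
  by rewrite divff// expf_neq0// gt_eqF.
have tb u : `|u| / r <= b -> `|u / r| <= b by rewrite normrM normfV (gtr0_norm r0).
have [d1 d2] := transverse_dev i j b4 (tb _ h0) (tb _ h1) ht.
rewrite (green_amplitudeE k i j (t := t))// -/r.
rewrite [transverse R i j]mxE addrAC -(rmorphB (real_complex R)).
apply: (le_trans (normcD _ _)); rewrite normc_real Normc.normcM normc_real.
rewrite (_ : 5 * b = b + b * 4); last by ring.
have b0 : 0 <= b by rewrite (le_trans _ d1).
apply: lerD => //; apply: ler_pM => //; [exact: normc_ge0| |].
  exact: le_trans (normc_mfac kr) kr'.
apply: (le_trans (ler_normB _ _)); rewrite normrM (ger0_norm (ler0n _ 3)) normr_nat.
have : (i == j)%:R <= 1 :> R by case: (i == j).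
by move: d2; rewrite /t; lra.
Qed.

Lemma transverse_mul (R : realType) : transverse R *m transverse R = transverse R.
Proof.
apply/matrixP => i j; rewrite !mxE sum3 !mxE.
by case: (ord3P i) => ->; case: (ord3P j) => ->; rewrite /= ?(mulr0, mul0r, mulr1, addr0, add0r).
Qed.

Lemma normc_transverse (R : realType) i j : Normc.normc (transverse R i j) <= 1.
Proof. by rewrite mxE normc_real normr_nat; case: (_ && _). Qed.

Lemma conj_transverse (R : realType) i j : conjc (transverse R i j) = transverse R i j.
Proof. by rewrite mxE conjc_real. Qed.

Lemma near_transverse_mul (R : realType) (D D' : 'M[R[i]]_3) (d : R) : d <= 1 / 2 ->
  (forall i j, Normc.normc (D i j - transverse R i j) <= d) ->
  (forall i j, Normc.normc (D' i j - transverse R i j) <= d) ->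
  forall i j, Normc.normc ((conj_mx D *m D') i j - transverse R i j) <= 8 * d.
Proof.
move=> d2 h h' i j.
have d0 : 0 <= d by rewrite (le_trans _ (h 0 0))// normc_ge0.
have step l : Normc.normc (conjc (D i l) * D' l j - transverse R i l * transverse R l j) <= 5 / 2 * d.
  rewrite (_ : _ - _ = (conjc (D i l) - transverse R i l) * D' l j +
    transverse R i l * (D' l j - transverse R l j)); last by ring.
  apply: (le_trans (normcD _ _)); rewrite !Normc.normcM.
  rewrite -{1}(conj_transverse R i l) -rmorphB normc_conj.
  have b1 : Normc.normc (D' l j) <= 3 / 2.
    rewrite -(subrK (transverse R l j) (D' l j)); apply: (le_trans (normcD _ _)).
    by have := h' l j; have := normc_transverse R l j; lra.
  rewrite (_ : 5 / 2 * d = d * (3 / 2) + 1 * d); last by field.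
  apply: lerD; apply: ler_pM; rewrite ?normc_ge0//.
  exact: normc_transverse.
rewrite -{1}transverse_mul !mxE.
rewrite -sumrB sum3 !mxE.
have := step 0; have := step 1; have := step 2%:R; rewrite !mxE => s2 s1 s0.
apply: (le_trans (normcD _ _)).
apply: (@le_trans _ _ (5 / 2 * d + 5 / 2 * d + 5 / 2 * d)); last by lra.
by apply: lerD => //; apply: (le_trans (normcD _ _)); apply: lerD.
Qed.

Lemma green_conjM (R : realType) (k : R) (x y y' : 'cV[R]_3) :
  conjc (green k x y) * green k x y' =
  expi (k * enorm3 (x - y') - k * enorm3 (x - y)) *
  ((16 * pi ^+ 2)^-1 * (enorm3 (x - y) * enorm3 (x - y'))^-1)%:C.
Proof.
rewrite /green -expi_conjM.
set r := enorm3 (x - y); set r' := enorm3 (x - y').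
have e (u : R) : (u%:C)^-1 = (u^-1)%:C by rewrite fmorphV.
have conjM (u v : R[i]) : conjc (u * v) = conjc u * conjc v by exact: (rmorphM (@conjc R)).
rewrite !e conjM conjc_real mulrACA; congr (_ * _).
rewrite -(rmorphM (real_complex R)); congr (_%:C).
rewrite (_ : (16 : R) = 4 * 4); last by ring.
by rewrite expr2 !invfM; ring.
Qed.

Lemma enorm3_point3 (R : realType) (x y : R * R) (z : R) :
  enorm3 (point3 x 0 - point3 y z) ^+ 2 =
  (x.1 - y.1) ^+ 2 + (x.2 - y.2) ^+ 2 + z ^+ 2.
Proof.
rewrite enorm3E (sum3 (fun i => (point3 x 0 - point3 y z) i 0 ^+ 2)) !mxE /=.
by rewrite sub0r sqrrN.
Qed.

Lemma green_near (R : realType) (k L a c z : R) (x y : R * R) :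
  0 < k -> 0 < a -> a <= c -> 64 * c <= L -> L <= k * a ^+ 2 ->
  `|x.1| <= c -> `|x.2| <= c -> `|y.1| <= c -> `|y.2| <= c -> `|z - L| <= c ->
  let r := enorm3 (point3 x 0 - point3 y z) in
  [/\ z <= r, (r - z) * L <= 8 * c ^+ 2, `|r - L| <= 2 * c & 15 * L <= 16 * z] /\
  forall i j, Normc.normc (green_amplitude k (point3 x 0) (point3 y z) i j -
    transverse R i j) <= 20 * c / L.
Proof.
move=> k0 a0 ac cL ka x1 x2 y1 y2 hz; set v := _ - _ => r.
have c0 : 0 < c by rewrite (lt_le_trans a0).
have L0 : 0 < L by lra.
have u1 : `|x.1 - y.1| <= 2 * c by rewrite (le_trans (ler_normB _ _))//; lra.
have u2 : `|x.2 - y.2| <= 2 * c by rewrite (le_trans (ler_normB _ _))//; lra.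
have z0 : 0 < z by move: hz; rewrite ler_distl => /andP[]; lra.
have r2 : r ^+ 2 = (x.1 - y.1) ^+ 2 + (x.2 - y.2) ^+ 2 + z ^+ 2 := enorm3_point3 x y z.
have r0 : 0 < r.
  by rewrite lt_neqAle sqrtr_ge0 eq_sym -sqrf_eq0 r2 gt_eqF// ltr_wpDl ?exprn_gt0// addr_ge0 ?sqr_ge0.
have cL' : 16 * c <= L by lra.
have db := dist_bounds c0 cL' u1 u2 hz r0 r2.
split => // i j; have [zr _ _ zL] := db.
have rL : 15 * L <= 16 * r by lra.
have kc : 64 <= k * c.
  apply: (@le_trans _ _ (k * a)); last by rewrite ler_pM2l.
  rewrite -(ler_pM2r a0) -mulrA -expr2; apply: le_trans ka; lra.
have kcr : 15 * L <= k * r * c.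
  rewrite mulrAC; apply: (le_trans rL); rewrite ler_pM2r//; lra.
have kr0 : 0 < k * r by rewrite mulr_gt0.
have ur (u : R) : `|u| <= 2 * c -> `|u| / r <= 4 * c / L.
  move=> hu; rewrite ler_pdivrMr// mulrAC ler_pdivlMr//.
  apply: (@le_trans _ _ (2 * c * L)); first by rewrite ler_wpM2r// ltW.
  rewrite -subr_ge0 (_ : _ - _ = 2 * c * (2 * r - L)); last by ring.
  by rewrite mulr_ge0//; lra.
have -> : 20 * c / L = 5 * (4 * c / L) by ring.
apply: green_amplitude_near => //; rewrite -/v -/r.
- by rewrite ler_pdivrMr//; lra.
- rewrite -(ler_pM2r c0) mul1r; lra.
- by rewrite ler_pdivrMr// mulrC mulrA ler_pdivlMr//; lra.
- by rewrite (_ : v 0 0 = x.1 - y.1) ?ur// !mxE.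
- by rewrite (_ : v 1 0 = x.2 - y.2) ?ur// !mxE.
Qed.

Definition kernel (R : realType) (k : R) (y y' : 'cV[R]_3) (x : R * R) : 'M[R[i]]_3 :=
  conj_mx (dyadic_green k (point3 x 0) y) *m dyadic_green k (point3 x 0) y'.

(* The Fraunhofer approximation of [k * (r' - r)]: the difference
   [r' ^+ 2 - r ^+ 2] is affine in [x], because the ranges agree. *)
Definition fraunhofer_psi (R : realType) (k z : R) (y y' : R * R) : R :=
  k * (y'.1 ^+ 2 + y'.2 ^+ 2 - y.1 ^+ 2 - y.2 ^+ 2) / (2 * z).

Definition fraunhofer_xi (R : realType) (k z : R) (y y' : R * R) : R * R :=
  (k * (y.1 - y'.1) / z, k * (y.2 - y'.2) / z).

Lemma kernelE (R : realType) (k : R) (y y' : 'cV[R]_3) (x : R * R) :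
  let p := point3 x 0 in
  kernel k y y' x = (expi (k * enorm3 (p - y') - k * enorm3 (p - y)) *
  ((16 * pi ^+ 2)^-1 * (enorm3 (p - y) * enorm3 (p - y'))^-1)%:C) *:
  (conj_mx (green_amplitude k p y) *m green_amplitude k p y').
Proof.
move=> p; rewrite -green_conjM /kernel !dyadic_greenE.
have -> : conj_mx (green k p y *: green_amplitude k p y) =
    conjc (green k p y) *: conj_mx (green_amplitude k p y).
  by apply/matrixP => i j; rewrite !mxE; exact: (rmorphM (@conjc R)).
by rewrite -scalemxAl -scalemxAr scalerA.
Qed.

Lemma sixteen_pi_sqr_ge1 (R : realType) : 1 <= 16 * pi ^+ 2 :> R.
Proof.
have h := pi_ge2 R; apply: (@le_trans _ _ (1 * 1)); first by rewrite mulr1.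
by apply: ler_pM => //; [lra|rewrite expr2; apply: (@le_trans _ _ (1 * 1)); [rewrite mulr1|apply: ler_pM; lra]].
Qed.

Lemma diff_sqr_bound (R : realType) (c x y y' : R) :
  0 < c -> `|x| <= c -> `|y| <= c -> `|y'| <= c ->
  `|(x - y') ^+ 2 - (x - y) ^+ 2| <= 8 * c ^+ 2.
Proof.
move=> c0 hx hy hy'.
rewrite (_ : _ - _ = (y - y') * (2 * x - y - y')); last by ring.
rewrite normrM (_ : 8 * _ = (2 * c) * (4 * c)); last by ring.
apply: ler_pM => //; first by rewrite (le_trans (ler_normB _ _))//; lra.
apply: (le_trans (ler_normB _ _)).
have : `|2 * x - y| <= 2 * `|x| + `|y|.
  by rewrite (le_trans (ler_normB _ _))// normrM (ger0_norm (ler0n _ 2)).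
lra.
Qed.

Lemma kernel_near (R : realType) (k L a c z : R) (x y y' : R * R) :
  0 < k -> 0 < a -> a <= c -> 64 * c <= L -> L <= k * a ^+ 2 ->
  `|x.1| <= c -> `|x.2| <= c -> `|y.1| <= c -> `|y.2| <= c ->
  `|y'.1| <= c -> `|y'.2| <= c -> `|z - L| <= c ->
  let xi := fraunhofer_xi k z y y' in
  forall i j, Normc.normc (kernel k (point3 y z) (point3 y' z) x i j -
    ((16 * pi ^+ 2 * L ^+ 2)^-1)%:C *
    expi (fraunhofer_psi k z y y' + (xi.1 * x.1 + xi.2 * x.2)) * transverse R i j) <=
  512 / L ^+ 2 * (c / L + k * c ^+ 4 / L ^+ 3).
Proof.
move=> k0 a0 ac cL ka x1 x2 y1 y2 y1' y2' hz xi i j.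
have c0 : 0 < c by rewrite (lt_le_trans a0).
have L0 : 0 < L by lra.
have cL' : 16 * c <= L by lra.
have [[zr rb rL zL] hD] := green_near k0 a0 ac cL ka x1 x2 y1 y2 hz.
have [[zr' rb' rL' _] hD'] := green_near k0 a0 ac cL ka x1 x2 y1' y2' hz.
rewrite kernelE; set p := point3 x 0 in zr rb rL hD zr' rb' rL' hD' *.
set r := enorm3 (p - point3 y z) in zr rb rL hD *.
set r' := enorm3 (p - point3 y' z) in zr' rb' rL' hD' *.
set Q := _ *m _.
have d2 : 20 * c / L <= 1 / 2 by rewrite ler_pdivrMr//; lra.
have hQ := near_transverse_mul d2 hD hD' i j; rewrite -/Q in hQ.
pose tau := k * r' - k * r.
pose n := r' ^+ 2 - r ^+ 2.
have nE : n = ((x.1 - y'.1) ^+ 2 - (x.1 - y.1) ^+ 2) + ((x.2 - y'.2) ^+ 2 - (x.2 - y.2) ^+ 2).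
  by rewrite /n /r /r' !enorm3_point3; ring.
have n16 : `|n| <= 16 * c ^+ 2.
  rewrite nE (_ : 16 * _ = 8 * c ^+ 2 + 8 * c ^+ 2); last by ring.
  by apply: (le_trans (ler_normD _ _)); apply: lerD; exact: diff_sqr_bound.
have z0 : 0 < z by lra.
pose tau0 := fraunhofer_psi k z y y' + (xi.1 * x.1 + xi.2 * x.2).
have tau0E : tau0 = k * (n / (2 * z)).
  by rewrite nE /tau0 /fraunhofer_psi /xi /fraunhofer_xi /=; field; rewrite gt_eqF.
have htau : `|tau - tau0| <= 256 * (k * c ^+ 4 / L ^+ 3).
  rewrite tau0E /tau -!mulrBr normrM (gtr0_norm k0).
  rewrite (_ : 256 * _ = k * (256 * c ^+ 4 / L ^+ 3)); last by ring.
  by rewrite ler_pM2l//; apply: (phase_bound c0 L0 zL).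
have hs := amplitude_bound c0 cL' rL rL'.
set q := (16 * pi ^+ 2)^-1.
have q1 : 0 <= q <= 1.
  have h := sixteen_pi_sqr_ge1 R.
  by rewrite invr_ge0 invf_le1 ?(lt_le_trans ltr01 h)// h (le_trans ler01 h).
have -> : (16 * pi ^+ 2 * L ^+ 2)^-1 = q * (L ^+ 2)^-1 by rewrite invfM.
have ik (B : 'M[R[i]]_3) (e : R[i]) : (e *: B) i j = e * B i j by rewrite mxE.
rewrite ik -/tau -/tau0.
set s := (r * r')^-1 in hs *; set s0 := (L ^+ 2)^-1 in hs *.
set P := transverse R i j in hQ *.
have s00 : 0 <= s0 by rewrite invr_ge0 sqr_ge0.
rewrite (_ : _ - _ = q%:C * (expi tau * ((s - s0)%:C * Q i j) +
  s0%:C * (expi tau * (Q i j - P) + (expi tau - expi tau0) * P))); last first.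
  by rewrite !rmorphM/= rmorphB/=; ring.
rewrite Normc.normcM normc_real.
have /andP[q0 q1'] := q1; rewrite (ger0_norm q0).
apply: (le_trans (ler_wpM2r (normc_ge0 _) q1')); rewrite mul1r.
have Q5 : Normc.normc (Q i j) <= 5.
  rewrite -(subrK P (Q i j)); apply: (le_trans (normcD _ _)).
  have := normc_transverse R i j; rewrite -/P; lra.
apply: (@le_trans _ _ (24 * c / L ^+ 3 * 5 +
   s0 * (8 * (20 * c / L) + 2 * (256 * (k * c ^+ 4 / L ^+ 3))))).
  apply: (le_trans (normcD _ _)); apply: lerD.
    rewrite Normc.normcM normc_expi mul1r Normc.normcM normc_real.
    by apply: ler_pM => //; exact: normc_ge0.
  rewrite Normc.normcM normc_real (ger0_norm s00) ler_wpM2l//.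
  apply: (le_trans (normcD _ _)); apply: lerD.
    by rewrite Normc.normcM normc_expi mul1r.
  rewrite Normc.normcM -[leRHS]mulr1; apply: ler_pM; rewrite ?normc_ge0//.
    apply: (le_trans (normc_expiB _ _)); rewrite ler_pM2l//.
  exact: normc_transverse.
rewrite (_ : 24 * c / L ^+ 3 * 5 = s0 * (120 * (c / L))); last first.
  by rewrite /s0; field; rewrite gt_eqF.
rewrite (_ : 512 / L ^+ 2 * _ = s0 * (512 * (c / L) + 512 * (k * c ^+ 4 / L ^+ 3))); last first.
  by rewrite /s0; ring.
rewrite -mulrDr ler_wpM2l//.
have cL0 : 0 <= c / L by rewrite divr_ge0// ltW.
rewrite (_ : 8 * (20 * c / L) = 160 * (c / L)); last by ring.
move: cL0; set u := c / L => u0; set w := k * _ / _; lra.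
Qed.

(** * Measurability and integration of the kernel *)

Definition measurableC (R : realType) (f : plane R -> R[i]) : Prop :=
  measurable_fun [set: plane R] (fun x => complex.Re (f x)) /\
  measurable_fun [set: plane R] (fun x => complex.Im (f x)).

Lemma measurableC_cst (R : realType) (z : R[i]) : measurableC (fun _ : plane R => z).
Proof. by split; exact: measurable_cst. Qed.

Lemma measurableC_real (R : realType) (u : plane R -> R) : measurable_fun [set: plane R] u ->
  measurableC (fun x => (u x)%:C).
Proof. by move=> mu; split => //=; exact: measurable_cst. Qed.

Lemma measurableC_D (R : realType) (f g : plane R -> R[i]) : measurableC f -> measurableC g ->
  measurableC (fun x => f x + g x).
Proof.
move=> [f1 f2] [g1 g2]; split.
  rewrite (_ : (fun _ => _) = (fun x => complex.Re (f x) + complex.Re (g x))).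
    exact: measurable_funD f1 g1.
  by apply/funext => x; case: (f x) (g x) => ? ? [].
rewrite (_ : (fun _ => _) = (fun x => complex.Im (f x) + complex.Im (g x))).
  exact: measurable_funD f2 g2.
by apply/funext => x; case: (f x) (g x) => ? ? [].
Qed.

Lemma measurableC_M (R : realType) (f g : plane R -> R[i]) : measurableC f -> measurableC g ->
  measurableC (fun x => f x * g x).
Proof.
move=> [f1 f2] [g1 g2]; split.
  rewrite (_ : (fun _ => _) = (fun x => complex.Re (f x) * complex.Re (g x) -
      complex.Im (f x) * complex.Im (g x))).
    exact: measurable_funB (measurable_funM f1 g1) (measurable_funM f2 g2).
  by apply/funext => x; case: (f x) (g x) => ? ? [].
rewrite (_ : (fun _ => _) = (fun x => complex.Re (f x) * complex.Im (g x) +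
    complex.Im (f x) * complex.Re (g x))).
  exact: measurable_funD (measurable_funM f1 g2) (measurable_funM f2 g1).
by apply/funext => x; case: (f x) (g x) => ? ? [].
Qed.

Lemma measurableC_conj (R : realType) (f : plane R -> R[i]) : measurableC f -> measurableC (fun x => conjc (f x)).
Proof.
move=> [f1 f2]; split.
  by rewrite (_ : (fun _ => _) = (fun x => complex.Re (f x))) //; apply/funext => x; case: (f x).
rewrite (_ : (fun _ => _) = (fun x => - complex.Im (f x))).
  exact: measurableT_comp f2.
by apply/funext => x; case: (f x).
Qed.

Lemma measurableC_expi (R : realType) (u : plane R -> R) : measurable_fun [set: plane R] u ->
  measurableC (fun x => expi (u x)).
Proof.
move=> mu; split.
  exact: measurableT_comp (@measurable_cos R) mu.
exact: measurableT_comp (@measurable_sin R) mu.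
Qed.

Lemma measurable_funV_ge0 (R : realType) (u : plane R -> R) : (forall x, 0 <= u x) ->
  measurable_fun [set: plane R] u -> measurable_fun [set: plane R] (fun x => (u x)^-1).
Proof.
move=> u0 mu; rewrite (_ : (fun _ => _) = (fun x => powR (u x) (- 1))).
  exact: (measurableT_comp (@measurable_powR R (- 1)) mu).
by apply/funext => x; rewrite powR_inv1.
Qed.

Lemma measurable_sqrt (R : realType) : measurable_fun [set: R] (@Num.sqrt R).
Proof. by apply: continuous_measurable_fun; exact: sqrt_continuous. Qed.

Lemma measurable_point3 (R : realType) (y : 'cV[R]_3) i :
  measurable_fun [set: plane R] (fun x => (point3 (x : R * R) 0 - y) i 0).
Proof.
case: (ord3P i) => ->.
- rewrite (_ : (fun _ => _) = (fun x : plane R => (x.1 : R) - y 0 0)).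
    by apply: measurable_funB; [exact: measurable_fst|exact: measurable_cst].
  by apply/funext => x; rewrite !mxE.
- rewrite (_ : (fun _ => _) = (fun x : plane R => (x.2 : R) - y 1 0)).
    by apply: measurable_funB; [exact: measurable_snd|exact: measurable_cst].
  by apply/funext => x; rewrite !mxE.
rewrite (_ : (fun _ => _) = cst (- y 2%:R 0)); first exact: measurable_cst.
by apply/funext => x; rewrite !mxE /= sub0r.
Qed.

Lemma measurable_dist (R : realType) (y : 'cV[R]_3) :
  measurable_fun [set: plane R] (fun x => enorm3 (point3 (x : R * R) 0 - y)).
Proof.
apply: (measurableT_comp (@measurable_sqrt R)).
pose p i := fun x : plane R => (point3 (x : R * R) 0 - y) i 0.
rewrite (_ : (fun _ => _) = (fun x => p 0 x ^+ 2 + p 1 x ^+ 2 + p 2%:R x ^+ 2)).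
  have mp i : measurable_fun [set: plane R] (fun x => p i x ^+ 2).
    by apply: measurable_funX; exact: measurable_point3.
  exact: measurable_funD (measurable_funD (mp 0) (mp 1)) (mp 2%:R).
apply/funext => x; exact: (sum3 (fun i => (point3 (x : R * R) 0 - y) i 0 ^+ 2)).
Qed.

Lemma measurable_entryC (R : realType) (k : R) (y : 'cV[R]_3) i j :
  measurableC (fun x : plane R => dyadic_green k (point3 (x : R * R) 0) y i j).
Proof.
pose r := fun x : plane R => enorm3 (point3 (x : R * R) 0 - y).
have mr : measurable_fun [set: plane R] r by exact: measurable_dist.
have r0 x : 0 <= r x by exact: sqrtr_ge0.
have mVr : measurable_fun [set: plane R] (fun x => (r x)^-1) by exact: measurable_funV_ge0.
have mkr : measurable_fun [set: plane R] (fun x => k * r x).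
  by apply: measurable_funM mr; exact: measurable_cst.
pose t i := fun x : plane R => (point3 (x : R * R) 0 - y) i 0 / r x.
have mt l : measurable_fun [set: plane R] (t l).
  by apply: measurable_funM mVr; exact: measurable_point3.
have mtt : measurable_fun [set: plane R] (fun x => t i x * t j x).
  exact: measurable_funM.
have mdelta (e : R) : measurable_fun [set: plane R] (fun x => (i == j)%:R - e * (t i x * t j x)).
  apply: measurable_funB; first exact: measurable_cst.
  by apply: measurable_funM mtt; exact: measurable_cst.
have mm : measurableC (fun x => mfac (k * r x)).
  rewrite (_ : (fun _ => _) = (fun x => ((k * r x)%:C * 'i + - 1) * (((k * r x) ^+ 2)^-1)%:C)).
    apply: measurableC_M.
      apply: measurableC_D; last exact: measurableC_cst.
      by apply: measurableC_M; [exact: measurableC_real|exact: measurableC_cst].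
    apply: measurableC_real; apply: measurable_funV_ge0; first by move=> x; exact: sqr_ge0.
    exact: measurable_funX.
  by apply/funext => x; rewrite /mfac -(fmorphV (real_complex R)).
have mg : measurableC (fun x : plane R => green k (point3 (x : R * R) 0) y).
  rewrite (_ : (fun _ => _) = (fun x => expi (k * r x) * ((4 * pi)^-1 * (r x)^-1)%:C)).
    apply: measurableC_M; first exact: measurableC_expi.
    by apply: measurableC_real; apply: measurable_funM mVr; exact: measurable_cst.
  by apply/funext => x; rewrite /green -/(r x) -(fmorphV (real_complex R)) invfM.
rewrite (_ : (fun _ => _) = (fun x => green k (point3 (x : R * R) 0) y *
   (((i == j)%:R - 1 * (t i x * t j x))%:C +
    mfac (k * r x) * ((i == j)%:R - 3 * (t i x * t j x))%:C))).
  apply: measurableC_M => //; apply: measurableC_D; first exact: measurableC_real.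
  by apply: measurableC_M => //; exact: measurableC_real.
apply/funext => x; rewrite dyadic_greenE mul1r.
rewrite -(green_amplitudeE k i j (x := point3 (x : R * R) 0) (t := fun i => t i x))//.
by rewrite mxE.
Qed.

Lemma measurable_kernel (R : realType) (k : R) (y y' : 'cV[R]_3) i j :
  measurableC (fun x : plane R => kernel k y y' (x : R * R) i j).
Proof.
pose f (l : 'I_3) := fun x : plane R =>
  conjc (dyadic_green k (point3 (x : R * R) 0) y i l) *
  dyadic_green k (point3 (x : R * R) 0) y' l j.
have mf l : measurableC (f l).
  by apply: measurableC_M; [apply: measurableC_conj|]; exact: measurable_entryC.
rewrite (_ : (fun _ => _) = (fun x => f 0 x + f 1 x + f 2%:R x)).
  by apply: measurableC_D => //; exact: measurableC_D.
apply/funext => x; rewrite /kernel mxE (eq_bigr (fun l => f l x)).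
  exact: (sum3 (fun l => f l x)).
by move=> l _; rewrite [conj_mx _ _ _]mxE.
Qed.

Definition integrableC (R : realType) (A : set (plane R)) (f : plane R -> R[i]) : Prop :=
  area.-integrable A (EFin \o (fun x => complex.Re (f x))) /\
  area.-integrable A (EFin \o (fun x => complex.Im (f x))).

Lemma integrableC_bounded (R : realType) (A : set (R * R)) (f : R * R -> R[i]) (r K : R) :
  measurable (A : set (plane R)) -> A `<=` box 0 r -> measurableC f ->
  (forall x, A x -> Normc.normc (f x) <= K) -> integrableC A f.
Proof.
move=> mA Ar [mf1 mf2] fK; split.
  apply: (bounded_integrable mA Ar (measurable_funTS mf1) (K := K)) => x Ax.
  exact: le_trans (normr_Re_le _) (fK x Ax).
apply: (bounded_integrable mA Ar (measurable_funTS mf2) (K := K)) => x Ax.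
exact: le_trans (normr_Im_le _) (fK x Ax).
Qed.

Lemma integrableC_D (R : realType) (A : set (plane R)) (f g : plane R -> R[i]) :
  measurable A -> integrableC A f -> integrableC A g -> integrableC A (fun x => f x + g x).
Proof.
move=> mA [f1 f2] [g1 g2]; split.
  rewrite (_ : _ \o _ = (EFin \o (fun x => complex.Re (f x))) \+ (EFin \o (fun x => complex.Re (g x)))).
    exact: integrableD.
  by apply/funext => x /=; case: (f x) (g x) => ? ? [].
rewrite (_ : _ \o _ = (EFin \o (fun x => complex.Im (f x))) \+ (EFin \o (fun x => complex.Im (g x)))).
  exact: integrableD.
by apply/funext => x /=; case: (f x) (g x) => ? ? [].
Qed.

Lemma integralC_D (R : realType) (A : set (plane R)) (f g : plane R -> R[i]) :
  measurable A -> integrableC A f -> integrableC A g ->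
  integralC A (fun x => f x + g x) = integralC A f + integralC A g.
Proof.
move=> mA [f1 f2] [g1 g2]; rewrite /integralC.
transitivity ((\int[area]_(x in A) (complex.Re (f x) + complex.Re (g x))) +i*
   (\int[area]_(x in A) (complex.Im (f x) + complex.Im (g x)))).
  congr (_ +i* _); apply: eq_Rintegral => x _.
    by case: (f x) (g x) => ? ? [].
  by case: (f x) (g x) => ? ? [].
by rewrite !RintegralD.
Qed.

Lemma integrableC_Mr (R : realType) (A : set (plane R)) (f : plane R -> R[i]) (z : R[i]) :
  measurable A -> integrableC A f -> integrableC A (fun x => f x * z).
Proof.
move=> mA [f1 f2]; case: z => a b.
have sc (u : plane R -> R) (e : R) : area.-integrable A (EFin \o u) ->
    area.-integrable A (fun x => (e%:E * (u x)%:E)%E).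
  by move=> h; exact: (integrableZl mA e h).
split.
  rewrite (_ : _ \o _ = (fun x => (a%:E * (complex.Re (f x))%:E)%E) \+ (fun x => ((- b)%:E * (complex.Im (f x))%:E)%E)).
    by apply: integrableD => //; exact: sc.
  apply/funext => x /=; case: (f x) => c d /=; rewrite -!EFinM -EFinD; congr (_%:E); ring.
rewrite (_ : _ \o _ = (fun x => (b%:E * (complex.Re (f x))%:E)%E) \+ (fun x => (a%:E * (complex.Im (f x))%:E)%E)).
  by apply: integrableD => //; exact: sc.
apply/funext => x /=; case: (f x) => c d /=; rewrite -!EFinM -EFinD; congr (_%:E); ring.
Qed.

Lemma integralC_Mr (R : realType) (A : set (plane R)) (f : plane R -> R[i]) (z : R[i]) :
  measurable A -> integrableC A f ->
  integralC A (fun x => f x * z) = integralC A f * z.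
Proof.
move=> mA [f1 f2]; case: z => a b.
have sc (u : plane R -> R) (e : R) : area.-integrable A (EFin \o u) ->
    area.-integrable A (EFin \o (fun x => e * u x)).
  by move=> h; exact: (integrableZl mA e h).
rewrite /integralC.
transitivity ((\int[area]_(x in A) (a * complex.Re (f x) + (- b) * complex.Im (f x))) +i*
   (\int[area]_(x in A) (b * complex.Re (f x) + a * complex.Im (f x)))).
  congr (_ +i* _); apply: eq_Rintegral => x _; case: (f x) => c d /=; ring.
rewrite !RintegralD//; try exact: sc.
by rewrite !RintegralZl//; apply/eqP; rewrite eq_complex /=; apply/andP; split; apply/eqP; ring.
Qed.

Lemma integral_mx_mulr (R : realType) (A : set (plane R)) (Q : R * R -> 'M[R[i]]_3) (N : 'M[R[i]]_3) :
  measurable A -> (forall i j, integrableC A (fun x => Q x i j)) ->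
  integral_mx A (fun x => Q x *m N) = integral_mx A Q *m N.
Proof.
move=> mA iQ; apply/matrixP => i j; rewrite !mxE sum3 !mxE.
have iQN l := integrableC_Mr (N l j) mA (iQ i l).
rewrite -!integralC_Mr// -integralC_D// -integralC_D//; last exact: integrableC_D.
by congr integralC; apply/funext => x; rewrite !mxE sum3.
Qed.

Lemma integral_mx_mull (R : realType) (A : set (plane R)) (Q : R * R -> 'M[R[i]]_3) (N : 'M[R[i]]_3) :
  measurable A -> (forall i j, integrableC A (fun x => Q x i j)) ->
  integral_mx A (fun x => N *m Q x) = N *m integral_mx A Q.
Proof.
move=> mA iQ; apply/matrixP => i j; rewrite !mxE sum3 !mxE.
have iQN l := integrableC_Mr (N i l) mA (iQ l j).
rewrite !(mulrC (N i _)) -!integralC_Mr// -integralC_D// -integralC_D//; last exact: integrableC_D.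
by congr integralC; apply/funext => x; rewrite !mxE sum3 !(mulrC (N i _)).
Qed.

Lemma dyadic_green_sym (R : realType) (k : R) (x y : 'cV[R]_3) :
  (dyadic_green k x y)^T = dyadic_green k x y.
Proof.
apply/matrixP => i j; rewrite dyadic_greenE mxE [LHS]mxE [RHS]mxE; congr (_ * _).
rewrite !(green_amplitudeE _ _ _ (t := fun i => (x - y) i 0 / enorm3 (x - y)))//.
by rewrite eq_sym (mulrC (_ / _)).
Qed.

Lemma dyadic_greenC (R : realType) (k : R) (x y : 'cV[R]_3) :
  dyadic_green k y x = dyadic_green k x y.
Proof.
have e : enorm3 (y - x) = enorm3 (x - y).
  by congr Num.sqrt; apply: eq_bigr => i _; rewrite -opprB mxE sqrrN.
rewrite /dyadic_green /green e -(opprB x y); congr (_ *: (_ - _ *: map_mx _ _)).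
by rewrite raddfN/= mulNmx mulmxN opprK.
Qed.

Lemma kernel_tr (R : realType) (k : R) (y y' : 'cV[R]_3) (x : R * R) :
  (kernel k y y' x)^T =
  dyadic_green k y' (point3 x 0) *m conj_mx (dyadic_green k (point3 x 0) y).
Proof.
rewrite /kernel trmx_mul dyadic_green_sym (dyadic_greenC k (point3 x 0)).
by congr (_ *m _); rewrite /conj_mx map_trmx dyadic_green_sym.
Qed.

Lemma integral_mx_tr (R : realType) (A : set (plane R)) (F : R * R -> 'M[R[i]]_3) :
  integral_mx A (fun x => (F x)^T) = (integral_mx A F)^T.
Proof.
by apply/matrixP => i j; rewrite !mxE; congr integralC; apply/funext => x; rewrite mxE.
Qed.

Lemma kirchhoff_imageE (R : realType) (A : set (plane R)) (k : R) (y y' : 'cV[R]_3)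
    (alpha : 'M[R[i]]_3) :
  measurable A -> (forall i j, integrableC A (fun x => kernel k y y' x i j)) ->
  kirchhoff_image A k y' alpha y =
  integral_mx A (kernel k y y') *m alpha *m (integral_mx A (kernel k y y'))^T.
Proof.
move=> mA iK.
have assoc (B C D E G : 'M[R[i]]_3) :
    B *m (C *m D *m E) *m G = (B *m C) *m (D *m (E *m G)).
  by rewrite !mulmxA.
transitivity (integral_mx A (fun xs =>
    integral_mx A (kernel k y y') *m alpha *m (kernel k y y' xs)^T)).
  congr integral_mx; apply/funext => xs.
  have E := integral_mx_mulr (alpha *m (kernel k y y' xs)^T) mA iK.
  rewrite mulmxA in E; rewrite -E.
  congr integral_mx; apply/funext => xr.
  rewrite kernel_tr; exact: assoc.
rewrite (integral_mx_mull (Q := fun xs => (kernel k y y' xs)^T) _ mA).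
  by rewrite integral_mx_tr.
move=> i j; rewrite (_ : (fun _ => _) = (fun x => kernel k y y' x j i)).
  exact: iK.
by apply/funext => x; rewrite mxE.
Qed.

Lemma normc_integralC_le (R : realType) (A : set (R * R)) (f : R * R -> R[i]) (r d : R) :
  measurable (A : set (plane R)) -> A `<=` box 0 r -> measurableC f ->
  (forall x, A x -> Normc.normc (f x) <= d) ->
  Normc.normc (integralC A f) <= 2 * d * fine (area A).
Proof.
move=> mA Ar [mf1 mf2] fd; apply: (le_trans (normc_le_add _)) => /=.
rewrite -mulrA (_ : 2 * _ = d * fine (area A) + d * fine (area A)); last by ring.
apply: lerD.
  apply: (normr_Rintegral_le mA Ar (measurable_funTS mf1)) => x Ax.
  exact: le_trans (normr_Re_le _) (fd x Ax).
apply: (normr_Rintegral_le mA Ar (measurable_funTS mf2)) => x Ax.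
exact: le_trans (normr_Im_le _) (fd x Ax).
Qed.

Lemma integralC_near (R : realType) (A : set (R * R)) (f g : R * R -> R[i]) (z : R[i]) (r d K : R) :
  measurable (A : set (plane R)) -> A `<=` box 0 r -> measurableC f -> measurableC g ->
  (forall x, A x -> Normc.normc (g x) <= K) ->
  (forall x, A x -> Normc.normc (f x - g x * z) <= d) ->
  Normc.normc (integralC A f - integralC A g * z) <= 2 * d * fine (area A).
Proof.
move=> mA Ar mf mg gK fg.
pose h x := f x - g x * z.
have mh : measurableC h.
  rewrite (_ : h = (fun x => f x + g x * - z)); last first.
    by apply/funext => x; rewrite /h mulrN.
  by apply: measurableC_D => //; apply: measurableC_M => //; exact: measurableC_cst.
have ig : integrableC A g := integrableC_bounded mA Ar mg gK.
have ih : integrableC A h := integrableC_bounded mA Ar mh fg.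
have -> : integralC A f = integralC A h + integralC A g * z.
  rewrite -(integralC_Mr z mA ig) -(integralC_D mA ih (integrableC_Mr z mA ig)).
  by congr integralC; apply/funext => x; rewrite /h subrK.
by rewrite addrK; exact: normc_integralC_le mA Ar mh fg.
Qed.

Lemma normc_integralC_expi (R : realType) (A : set (R * R)) (xi : R * R) (psi W : R) :
  (forall psi, `|\int[area]_(x in A) cos (psi + (xi.1 * x.1 + xi.2 * x.2))| <= W) ->
  Normc.normc (integralC A (fun x => expi (psi + (xi.1 * x.1 + xi.2 * x.2)))) <= 2 * W.
Proof.
move=> hW; apply: (le_trans (normc_le_add _)); rewrite (_ : 2 * W = W + W); last by ring.
apply: lerD; first exact: hW.
rewrite (_ : complex.Im _ = \int[area]_(x in A) cos (psi - pi / 2 + (xi.1 * x.1 + xi.2 * x.2))); first exact: hW.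
apply: eq_Rintegral => x _ /=.
rewrite (_ : psi - pi / 2 + _ = psi + (xi.1 * x.1 + xi.2 * x.2) - pi / 2); last by ring.
by rewrite cosB cos_pihalf sin_pihalf mulr0 mulr1 add0r.
Qed.

Lemma measurableC_expi_phase (R : realType) (xi : R * R) (psi : R) :
  measurableC (fun x : plane R => expi (psi + (xi.1 * x.1 + xi.2 * x.2))).
Proof. by apply: measurableC_expi; exact: measurable_phase. Qed.

Lemma area_box_le (R : realType) (A : set (R * R)) (r : R) : 0 <= r ->
  measurable (A : set (plane R)) -> A `<=` box 0 r -> fine (area A) <= 4 * r ^+ 2.
Proof.
move=> r0 mA Ar; have h := @area_cover _ A [:: 0] r r0 mA.
rewrite -[leRHS]mul1r; apply: h => x Ax; exists 0; first by rewrite inE.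
exact: Ar.
Qed.

(** * Area of the disk *)

Lemma half_disk_integral (R : realType) (a : R) : 0 < a ->
  (\int[lebesgue_measure]_(x in `[(- a)%R, a]) (2 * Num.sqrt (a ^+ 2 - x ^+ 2))%:E =
   (pi * a ^+ 2)%:E)%E.
Proof.
move=> a0.
pose F t := a * sin t : R.
pose G x := 2 * Num.sqrt (a ^+ 2 - x ^+ 2) : R.
have Fb : F (pi / 2) = a by rewrite /F sin_pihalf mulr1.
have Fa : F (- (pi / 2)) = - a by rewrite /F sinN sin_pihalf mulrN mulr1.
have p2 : - (pi / 2) < pi / 2 :> R by have := pi_gt0 R; lra.
have dF (t : R) : is_derive t 1 F (a * cos t).
  by rewrite /F; apply: is_derive_eq.
have dFE : F^`() = (fun t => a * cos t).
  by apply/funext => t; rewrite derive1E; apply: derive_val.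
have cF : continuous F.
  move=> t; apply/differentiable_continuous/derivable1_diffP; exact: ex_derive.
have cdF : continuous F^`().
  rewrite dFE => t; apply: cvgM; [exact: cvg_cst|exact: continuous_cos].
have cG : continuous G.
  have cg : continuous (fun x : R => a ^+ 2 - x ^+ 2).
    by move=> x; apply: cvgB; [exact: cvg_cst|exact: exprn_continuous].
  move=> x; apply: cvgM; first exact: cvg_cst.
  exact: (cvg_comp _ _ (cg x) (@sqrt_continuous R _)).
have sub := @integration_by_substitution_increasing R F G (- (pi / 2)) (pi / 2).
rewrite Fa Fb in sub; rewrite sub; first last.
- exact: continuous_subspaceT.
- split; first by move=> t _; exact: ex_derive.
  + exact/cvg_at_right_filter/cF.
  + exact/cvg_at_left_filter/cF.
- by apply/cvg_ex; exists (F^`() (pi / 2)); exact/cvg_at_left_filter/cdF.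
- by apply/cvg_ex; exists (F^`() (- (pi / 2))); exact/cvg_at_right_filter/cdF.
- by move=> t _; exact: cdF.
- by move=> t u ht hu tu; rewrite /F ltr_pM2l// ltr_sin.
- exact: ltW.
pose H t := a ^+ 2 * (t + sin t * cos t) : R.
have dH (t : R) : is_derive t 1 H (2 * (a * cos t) ^+ 2).
  rewrite /H; apply: is_derive_eq.
  rewrite /GRing.scale/=.
  by rewrite -{1}(cos2Dsin2 t); ring.
transitivity (\int[lebesgue_measure]_(x in `[(- (pi / 2))%R, (pi / 2)%R]) (2 * (a * cos x) ^+ 2)%:E)%E.
  apply: eq_integral => t; rewrite inE/= in_itv/= => /andP[t1 t2]; congr (_%:E).
  have ct : 0 <= cos t by apply: cos_ge0_pihalf; rewrite t1 t2.
  rewrite dFE /G /F /= /GRing.mul/=.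
  have -> : a ^+ 2 - (a * sin t) ^+ 2 = (a * cos t) ^+ 2.
    by rewrite !exprMn cos2sin2 mulrBr mulr1.
  by rewrite sqrtr_sqr ger0_norm ?mulr_ge0 ?(ltW a0)// -mulrA -expr2.
rewrite (@continuous_FTC2 _ _ H)//.
- rewrite /H -EFinB !sinN !cosN cos_pihalf; congr (_%:E); by field.
- apply: continuous_subspaceT => t; apply: cvgM; first exact: cvg_cst.
  have c : continuous (fun t => a * cos t).
    by move=> u; apply: cvgM; [exact: cvg_cst|exact: continuous_cos].
  exact: (cvg_comp _ _ (c t) (@exprn_continuous R 2 _)).
- have cH : continuous H.
    move=> t; apply/differentiable_continuous/derivable1_diffP; exact: ex_derive.
  split; first by move=> t _; exact: ex_derive.
  + exact/cvg_at_right_filter/cH.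
  + exact/cvg_at_left_filter/cH.
- by move=> t _; rewrite derive1E; apply: derive_val.
Qed.

Lemma measurable_disk (R : realType) (a : R) :
  measurable (disk_array a : set (plane R)).
Proof.
have me : measurable_fun [set: plane R] (fun x : plane R => enorm2 (x : R * R)).
  apply: (measurableT_comp (@measurable_sqrt R)).
  apply: measurable_funD; apply: measurable_funX;
    [exact: measurable_fst|exact: measurable_snd].
rewrite (_ : disk_array a = [set: plane R] `&` (fun x : plane R => enorm2 (x : R * R)) @^-1` `]-oo, a]).
  by apply: me => //; exact: measurable_itv.
by rewrite setTI; apply/seteqP; split => x; rewrite /disk_array /= in_itv.
Qed.

Lemma disk_array_box (R : realType) (a : R) : disk_array a `<=` box (0 : R * R) a.
Proof.
move=> x xa; apply/boxP; rewrite !subr0; split.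
  exact: le_trans (enorm2_ge1 x) xa.
exact: le_trans (enorm2_ge2 x) xa.
Qed.

Lemma area_disk (R : realType) (a : R) : 0 < a ->
  area (disk_array a) = (pi * a ^+ 2)%:E.
Proof.
move=> a0; rewrite -(half_disk_integral a0) [RHS]integral_mkcond /area /product_measure1.
apply: eq_integral => x _; rewrite /= patchE.
set s := Num.sqrt (a ^+ 2 - x ^+ 2).
have s0 : 0 <= s by exact: sqrtr_ge0.
have [xa|xa] := boolP (x \in `[(- a), a]%classic); last first.
  rewrite (_ : xsection _ _ = set0) ?measure0//.
  apply/seteqP; split => // y; rewrite /xsection /= inE => h; exfalso.
  move/negP: xa; apply; rewrite inE /= in_itv /= -ler_norml.
  exact: le_trans (enorm2_ge1 (x, y)) h.
have xa2 : x ^+ 2 <= a ^+ 2.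
  by move: xa; rewrite inE /= in_itv /= -ler_norml => h; rewrite -real_normK ?num_real// ler_sqr ?nnegrE// ltW.
rewrite (_ : xsection _ _ = `[(- s)%R, s]%classic).
  rewrite lebesgue_measure_itv /= lte_fin.
  case: ltP => h; first by rewrite -EFinD; congr (_%:E); ring.
  by congr (_%:E); lra.
have diskE (y : R) : disk_array a (x, y) <-> `|y| <= s.
  rewrite /disk_array /= -(ler_sqr (x := enorm2 _)) ?nnegrE ?sqrtr_ge0 ?(ltW a0)//.
  rewrite enorm2_sqr /= -lerBrDl -(@sqr_sqrtr _ (a ^+ 2 - x ^+ 2)) ?subr_ge0// -/s.
  by rewrite -[y ^+ 2]real_normK ?num_real// ler_sqr ?nnegrE.
apply/seteqP; split => y.
  by rewrite /xsection /= inE => /diskE; rewrite in_itv /= -ler_norml.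
by rewrite /= in_itv /= -ler_norml => /diskE h; rewrite /xsection /= inE.
Qed.

(** * Bounds on the imaging function *)

Lemma normc_le_fnorm (R : realType) (M : 'M[R[i]]_3) i j : Normc.normc (M i j) <= fnorm M.
Proof.
rewrite -[leLHS]ger0_norm ?normc_ge0// -sqrtr_sqr ler_wsqrtr//.
rewrite (bigD1 i)//= (bigD1 j)//= -addrA lerDl addr_ge0//.
  by apply: sumr_ge0 => l _; exact: sqr_ge0.
by apply: sumr_ge0 => l _; apply: sumr_ge0 => l' _; exact: sqr_ge0.
Qed.

Lemma fnorm_le (R : realType) (M : 'M[R[i]]_3) (m : R) :
  (forall i j, Normc.normc (M i j) <= m) -> fnorm M <= 3 * m.
Proof.
move=> hM; have m0 : 0 <= m by rewrite (le_trans _ (hM 0 0))// normc_ge0.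
rewrite -[leRHS]ger0_norm ?mulr_ge0// -sqrtr_sqr ler_wsqrtr//.
have sq i j : Normc.normc (M i j) ^+ 2 <= m ^+ 2.
  by rewrite ler_sqr ?nnegrE ?normc_ge0.
rewrite (_ : (3 * m) ^+ 2 = 3 * (3 * m ^+ 2)); last by ring.
rewrite sum3 !sum3.
have row i : Normc.normc (M i 0) ^+ 2 + Normc.normc (M i 1) ^+ 2 + Normc.normc (M i 2%:R) ^+ 2 <= 3 * m ^+ 2.
  by have := sq i 0; have := sq i 1; have := sq i 2%:R; lra.
by have := row 0; have := row 1; have := row 2%:R; lra.
Qed.

Lemma normc_mulmx_le (R : realType) (A B : 'M[R[i]]_3) (a b : R) :
  (forall i j, Normc.normc (A i j) <= a) -> (forall i j, Normc.normc (B i j) <= b) ->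
  forall i j, Normc.normc ((A *m B) i j) <= 3 * (a * b).
Proof.
move=> hA hB i j; rewrite mxE sum3.
have st l : Normc.normc (A i l * B l j) <= a * b.
  by rewrite Normc.normcM; apply: ler_pM => //; exact: normc_ge0.
rewrite (_ : 3 * _ = a * b + a * b + a * b); last by ring.
apply: (le_trans (normcD _ _)); apply: lerD => //.
by apply: (le_trans (normcD _ _)); apply: lerD.
Qed.

Lemma fnorm_congr_le (R : realType) (A M : 'M[R[i]]_3) (B : 'M[R[i]]_3) (a b m : R) :
  (forall i j, Normc.normc (A i j) <= a) -> (forall i j, Normc.normc (B i j) <= b) ->
  fnorm M <= m -> fnorm (A *m M *m B^T) <= 27 * (a * b * m).
Proof.
move=> hA hB hM.
have hM' i j : Normc.normc (M i j) <= m := le_trans (normc_le_fnorm M i j) hM.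
have hBT i j : Normc.normc (B^T i j) <= b by rewrite mxE.
have h := normc_mulmx_le (normc_mulmx_le hA hM') hBT.
by apply: (le_trans (fnorm_le h)); rewrite le_eqVlt; apply/orP; left; apply/eqP; ring.
Qed.

Lemma fnormD_le (R : realType) (A B : 'M[R[i]]_3) (a b : R) :
  fnorm A <= a -> fnorm B <= b -> fnorm (A + B) <= 3 * (a + b).
Proof.
move=> hA hB; apply: fnorm_le => i j; rewrite mxE.
apply: (le_trans (normcD _ _)); apply: lerD.
  exact: le_trans (normc_le_fnorm A i j) hA.
exact: le_trans (normc_le_fnorm B i j) hB.
Qed.

Lemma cross_range_blockE (R : realType) (M : 'M[R[i]]_3) :
  cross_range_block M = transverse R *m M *m (transverse R)^T.
Proof.
have PMP i j : (transverse R *m M *m (transverse R)^T) i j =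
    if (i < 2)%N && (j < 2)%N then M i j else 0.
  rewrite mxE sum3 ![(transverse R)^T _ _]mxE ![(transverse R *m M) _ _]mxE !sum3 !mxE.
  by case: (ord3P i) => ->; case: (ord3P j) => ->;
    rewrite /= ?(mulr0, mul0r, mulr1, mul1r, addr0, add0r).
apply/matrixP => i j; rewrite PMP /cross_range_block.
case: (@split_ordP 2 1 i) => i' ->; case: (@split_ordP 2 1 j) => j' ->.
- transitivity (ulsubmx (M : 'M[R[i]]_(2 + 1)) i' j'); first exact: block_mxEul.
  by rewrite [LHS]mxE [LHS]mxE.
- transitivity ((0 : 'M[R[i]]_(2, 1)) i' j'); first exact: block_mxEur.
  by rewrite [LHS]mxE.
- transitivity ((0 : 'M[R[i]]_(1, 2)) i' j'); first exact: block_mxEdl.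
  by rewrite [LHS]mxE.
transitivity ((0 : 'M[R[i]]_1) i' j'); first exact: block_mxEdr.
by rewrite [LHS]mxE.
Qed.

Lemma kernel_integral_near (R : realType) : exists2 K : R, 0 <= K &
  forall (A : set (R * R)) (k L a c z : R) (y y' : R * R),
  measurable (A : set (plane R)) -> A `<=` box 0 c ->
  0 < k -> 0 < a -> a <= c -> 64 * c <= L -> L <= k * a ^+ 2 ->
  `|y.1| <= c -> `|y.2| <= c -> `|y'.1| <= c -> `|y'.2| <= c -> `|z - L| <= c ->
  let xi := fraunhofer_xi k z y y' in
  (forall i j, integrableC A (fun x => kernel k (point3 y z) (point3 y' z) x i j)) /\
  forall i j, Normc.normc (integral_mx A (kernel k (point3 y z) (point3 y' z)) i j -
    integralC A (fun x => expi (fraunhofer_psi k z y y' + (xi.1 * x.1 + xi.2 * x.2))) *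
    ((16 * pi ^+ 2 * L ^+ 2)^-1%:C * transverse R i j)) <=
  K * (c ^+ 2 / L ^+ 2) * (c / L + k * c ^+ 4 / L ^+ 3).
Proof.
exists (8 * 512); first exact: (mulr_ge0 (ler0n _ 8) (ler0n _ 512)).
move=> A k L a c z y y' mA Ac k0 a0 ac cL ka y1 y2 y1' y2' hz xi.
have c0 : 0 < c by rewrite (lt_le_trans a0).
set q : R := (_ * _)^-1.
set d := 512 / L ^+ 2 * (c / L + k * c ^+ 4 / L ^+ 3).
have L0 : 0 < L by rewrite (lt_le_trans _ cL)// mulr_gt0.
have d0 : 0 <= d.
  have [c0' k0' L0'] := And3 (ltW c0) (ltW k0) (ltW L0).
  apply: mulr_ge0; first exact: divr_ge0 (ler0n _ _) (exprn_ge0 _ L0').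
  apply: addr_ge0; first exact: divr_ge0.
  exact: divr_ge0 (mulr_ge0 k0' (exprn_ge0 _ c0')) (exprn_ge0 _ L0').
pose g (x : R * R) := expi (fraunhofer_psi k z y y' + (xi.1 * x.1 + xi.2 * x.2)).
have near_g i j x : A x -> Normc.normc (kernel k (point3 y z) (point3 y' z) x i j -
    g x * (q%:C * transverse R i j)) <= d.
  move=> /Ac /boxP; rewrite !subr0 => -[x1 x2].
  rewrite mulrA (mulrC (g x)); exact: (kernel_near k0 a0 ac cL ka).
have g1 x : Normc.normc (g x) <= 1 by rewrite normc_expi.
have mg : measurableC g by exact: measurableC_expi_phase.
split=> i j.
  apply: (integrableC_bounded mA Ac (@measurable_kernel R k _ _ i j)
     (K := d + Normc.normc (q%:C * transverse R i j))) => x Ax.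
  set w := q%:C * _ in near_g *.
  rewrite -(subrK (g x * w) (kernel _ _ _ _ _ _)); apply: (le_trans (normcD _ _)).
  by rewrite lerD ?near_g// Normc.normcM normc_expi mul1r.
have h := integralC_near mA Ac (@measurable_kernel R k (point3 y z) (point3 y' z) i j) mg
  (fun x _ => g1 x) (fun x Ax => near_g i j x Ax).
rewrite [integral_mx _ _ _ _]mxE; apply: (le_trans h).
rewrite (_ : 8 * 512 * (c ^+ 2 / L ^+ 2) * (c / L + k * c ^+ 4 / L ^+ 3) = 2 * d * (4 * c ^+ 2)); last first.
  by rewrite /d; ring.
apply: ler_wpM2l; last exact: (area_box_le (ltW c0) mA Ac).
by apply: mulr_ge0.
Qed.

Lemma fraunhofer_xi_norm (R : realType) (k z : R) (y y' : R * R) : 0 < k -> 0 < z ->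
  enorm2 (fraunhofer_xi k z y y') = k / z * enorm2 (y - y').
Proof.
move=> k0 z0; rewrite /enorm2 /fraunhofer_xi /=.
rewrite (_ : _ + _ = (k / z) ^+ 2 * ((y.1 - y'.1) ^+ 2 + (y.2 - y'.2) ^+ 2)); last first.
  by field; rewrite gt_eqF.
by rewrite sqrtrM ?sqr_ge0// sqrtr_sqr ger0_norm// divr_ge0// ltW.
Qed.

Lemma enorm2_gt0 (R : realType) (y y' : R * R) : y <> y' -> 0 < enorm2 (y - y').
Proof.
move=> yy'; rewrite lt_neqAle sqrtr_ge0 eq_sym andbT; apply/negP => /eqP e.
apply: yy'; have e1 := enorm2_ge1 (y - y'); have e2 := enorm2_ge2 (y - y').
rewrite e !normr_le0 !subr_eq0 in e1 e2.
by case: y y' e1 e2 {e} => [? ?] [? ?] /= /eqP -> /eqP ->.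
Qed.

Lemma enorm2_le (R : realType) (x : R * R) : enorm2 x <= `|x.1| + `|x.2|.
Proof.
rewrite -[leRHS]ger0_norm ?addr_ge0// -[leRHS]sqrtr_sqr ler_wsqrtr//.
by rewrite sqrrD !real_normK ?num_real// lerD2r lerDl mulrn_wge0// mulr_ge0.
Qed.

Lemma geom_le_add (R : realType) (e u v : R) : 0 <= u -> 0 <= v -> 0 <= e ->
  e ^+ 2 = u * v -> e <= u + v.
Proof.
move=> u0 v0 e0 euv; rewrite -(ler_sqr (x := e)) ?nnegrE ?addr_ge0// euv.
have := mulr_ge0 u0 v0; have := sqr_ge0 u; have := sqr_ge0 v.
by rewrite sqrrD mulr2n; lra.
Qed.

(* The relative error [a / L] of the paraxial amplitudes is absorbed, by the
   inequality of means, into the quartic phase error [k a ^ 4 / L ^ 3] and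
   [L / (k a ^ 2)], and the latter is at most the cross-range term because the
   points are closer than the array size. *)
Lemma relative_error_le (R : realType) (k L a B d : R) :
  0 < k -> 0 < L -> 0 < a -> 1 <= B -> 0 < d -> d <= 4 * B * a ->
  a / L <= k * a ^+ 4 / L ^+ 3 + 4 * B * (L / (a * k * d)).
Proof.
move=> k0 L0 a0 B1 d0 dB; have B0 : 0 < B by lra.
have [k0' L0' a0'] := And3 (ltW k0) (ltW L0) (ltW a0).
apply: (@le_trans _ _ (k * a ^+ 4 / L ^+ 3 + L / (k * a ^+ 2))).
  apply: geom_le_add.
  - by apply: divr_ge0; [apply: mulr_ge0 => //; exact: exprn_ge0|exact: exprn_ge0].
  - by apply: divr_ge0 => //; apply: mulr_ge0 => //; exact: exprn_ge0.
  - exact: divr_ge0.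
  - by field; rewrite !gt_eqF.
rewrite lerD2l ler_pdivrMr ?mulr_gt0 ?exprn_gt0//.
rewrite (_ : 4 * B * _ * _ = (4 * B * a) / d * L); last first.
  by field; rewrite !gt_eqF.
by rewrite ler_peMl// ler_pdivlMr// mul1r.
Qed.

Lemma sqr_add_le (R : realType) (x y : R) : (x + y) ^+ 2 <= 2 * (x ^+ 2 + y ^+ 2).
Proof. by rewrite -subr_ge0 (_ : _ - _ = (x - y) ^+ 2) ?sqr_ge0//; ring. Qed.

Lemma inv_16pi2_le (R : realType) (L : R) : 0 < L ->
  0 <= (16 * pi ^+ 2 * L ^+ 2)^-1 <= (L ^+ 2)^-1.
Proof.
move=> L0; have p1 := sixteen_pi_sqr_ge1 R.
have q0 : 0 < 16 * pi ^+ 2 * L ^+ 2 :> R.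
  by rewrite mulr_gt0 ?exprn_gt0// (lt_le_trans ltr01).
rewrite invr_ge0 (ltW q0)/= lef_pV2 ?posrE ?exprn_gt0//.
by rewrite ler_peMl// exprn_ge0// ltW.
Qed.

Lemma cross_kernel_bound (R : realType) (A : set (R * R)) (B : R) :
  bounded_piecewise_smooth_domain A -> 1 <= B -> A `<=` box 0 B ->
  exists2 K, 0 <= K & forall (k L a z : R) (y y' : R * R),
  0 < k -> 0 < a -> 64 * (B * a) <= L -> L <= k * a ^+ 2 ->
  `|y.1| <= B * a -> `|y.2| <= B * a -> `|y'.1| <= B * a -> `|y'.2| <= B * a ->
  `|z - L| <= B * a -> y <> y' ->
  forall i j, Normc.normc (integral_mx (scaled_array a A)
      (kernel k (point3 y z) (point3 y' z)) i j) <=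
    a ^+ 2 / L ^+ 2 * (K * (L / (a * k * enorm2 (y - y')) + k * a ^+ 4 / L ^+ 3)).
Proof.
move=> domA B1 AB; have [Co Co0 osc] := oscillatory_integral domA.
have [_ mA _ _ _] := domA.
have [K0 K00 hK0] := kernel_integral_near R.
have B0 : 0 < B by exact: lt_le_trans B1.
exists (4 * Co + 8 * K0 * B ^+ 7).
  apply: addr_ge0; first exact: mulr_ge0 (ler0n _ _) Co0.
  exact: mulr_ge0 (mulr_ge0 (ler0n _ _) K00) (exprn_ge0 _ (ltW B0)).
move=> k L a z y y' k0 a0 BL ka y1 y2 y1' y2' hz yy' i j.
have c0 : 0 < B * a by rewrite mulr_gt0.
have L0 : 0 < L by lra.
have ac : a <= B * a by rewrite ler_peMl// ltW.
have d0 := enorm2_gt0 yy'.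
have mB : measurable (scaled_array a A : set (plane R)) by exact: measurable_scaled_array.
have Bc : scaled_array a A `<=` box 0 (B * a).
  by rewrite mulrC; exact: scaled_array_box.
have [_ hK] := hK0 _ _ _ _ _ _ _ _ mB Bc k0 a0 ac BL ka y1 y2 y1' y2' hz.
have {hK} := hK i j.
have {hz} /andP[z1 z2] : L - B * a <= z <= L + B * a by rewrite -ler_distl.
have z0 : 0 < z by lra.
have xin := fraunhofer_xi_norm y y' k0 z0.
set xi := fraunhofer_xi k z y y' in xin *.
set psi := fraunhofer_psi k z y y'.
set I := integralC _ _; set H := integral_mx _ _ i j; set d := enorm2 (y - y') in d0 xin *.
set q := (16 * pi ^+ 2 * L ^+ 2)^-1; set P := transverse R i j => hK.
have xi0 : 0 < enorm2 xi by rewrite xin mulr_gt0// divr_gt0.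
have hI : Normc.normc I <= 2 * (Co * a / enorm2 xi).
  by apply: normc_integralC_expi => psi'; exact: osc.
have dB : d <= 4 * B * a.
  apply: (le_trans (enorm2_le _)); rewrite /=.
  have := ler_normB y.1 y'.1; have := ler_normB y.2 y'.2; lra.
have re := relative_error_le k0 L0 a0 B1 d0 dB.
have /andP[q0 q1] := inv_16pi2_le L0; rewrite -/q in q0 q1.
have hP : Normc.normc P <= 1 by exact: normc_transverse.
clearbody I H P; clear hK0 osc.
have step1 : Normc.normc H <= 2 * (Co * a / enorm2 xi) * q +
    K0 * ((B * a) ^+ 2 / L ^+ 2) * (B * a / L + k * (B * a) ^+ 4 / L ^+ 3).
  rewrite -(subrK (I * (q%:C * P)) H) addrC; apply: (le_trans (normcD _ _)).
  apply: lerD; last exact: hK.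
  rewrite Normc.normcM Normc.normcM normc_real (ger0_norm q0).
  apply: ler_pM; [exact: normc_ge0|by apply: mulr_ge0 => //; exact: normc_ge0|exact: hI|].
  by rewrite ler_piMr.
apply: (le_trans step1); rewrite xin.
set X := L / (a * k * d); set w := k * a ^+ 4 / L ^+ 3 in re *.
have X0 : 0 <= X by apply: divr_ge0; [exact: ltW|apply: ltW; rewrite !mulr_gt0].
have [k0' L0' a0'] := And3 (ltW k0) (ltW L0) (ltW a0).
have w0 : 0 <= w by apply: divr_ge0; [apply: mulr_ge0 => //; exact: exprn_ge0|exact: exprn_ge0].
have t1 : 2 * (Co * a / (k / z * d)) * q <= a ^+ 2 / L ^+ 2 * (4 * Co * X).
  rewrite (_ : a ^+ 2 / L ^+ 2 * (4 * Co * X) = 4 * Co * a * L / (k * d) * (L ^+ 2)^-1); last first.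
    by rewrite /X; field; rewrite !gt_eqF.
  apply: ler_pM => //.
    by apply: mulr_ge0 => //; apply: divr_ge0; [exact: mulr_ge0|rewrite -xin; exact: ltW].
  rewrite (_ : 2 * (Co * a / (k / z * d)) = 2 * Co * a * z / (k * d)); last first.
    by field; rewrite !gt_eqF.
  have kd0 : 0 < k * d by rewrite mulr_gt0.
  rewrite ler_pM2r ?invr_gt0//.
  rewrite (_ : 4 * Co * a * L = 2 * Co * a * (2 * L)); last by ring.
  by rewrite ler_wpM2l ?mulr_ge0//; lra.
have t2 : K0 * ((B * a) ^+ 2 / L ^+ 2) * (B * a / L + k * (B * a) ^+ 4 / L ^+ 3) <=
    a ^+ 2 / L ^+ 2 * (8 * K0 * B ^+ 7 * (X + w)).
  rewrite (_ : K0 * _ * _ = a ^+ 2 / L ^+ 2 * (K0 * B ^+ 2 * (B * (a / L) + B ^+ 4 * w))); last first.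
    by rewrite /w; ring.
  apply: ler_wpM2l; first by apply: divr_ge0; exact: exprn_ge0.
  have B14 : B <= B ^+ 4 by apply: ler_eXnr.
  have B45 : B ^+ 4 <= B ^+ 5 by apply: ler_weXn2l.
  have B40 : 0 <= B ^+ 4 by apply: exprn_ge0; lra.
  apply: (@le_trans _ _ (K0 * B ^+ 2 * (8 * B ^+ 5 * (X + w)))); last first.
    by rewrite le_eqVlt; apply/orP; left; apply/eqP; ring.
  apply: ler_wpM2l; first by apply: mulr_ge0 => //; apply: exprn_ge0; lra.
  have s1 : B * (a / L) <= B ^+ 4 * (w + 4 * B * X).
    by apply: ler_pM => //; [lra|exact: divr_ge0].
  apply: (le_trans (lerD s1 (lexx (B ^+ 4 * w)))).
  rewrite [leLHS](_ : _ = 2 * (B ^+ 4 * w) + 4 * (B ^+ 5 * X)); last by ring.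
  rewrite [leRHS](_ : _ = 8 * (B ^+ 5 * X) + 8 * (B ^+ 5 * w)); last by ring.
  have := ler_wpM2r w0 B45.
  have : 0 <= B ^+ 5 * X by apply: mulr_ge0 => //; apply: exprn_ge0; lra.
  have : 0 <= B ^+ 4 * w by exact: mulr_ge0.
  set u1 := B ^+ 4 * w; set u2 := B ^+ 5 * X; set u3 := B ^+ 5 * w; lra.
apply: (le_trans (lerD t1 t2)); rewrite -mulrDr.
apply: ler_wpM2l; first by apply: divr_ge0; exact: exprn_ge0.
rewrite [leRHS]mulrDl; apply: lerD => //.
apply: ler_wpM2l; first exact: mulr_ge0.
by rewrite lerDl.
Qed.

Lemma in_window_bounds (R : realType) (c B a b h : R) (y : R * R) (eta : R) :
  0 < a -> 0 < b -> 0 < h -> 0 <= B -> c <= B -> b <= a -> h <= a -> in_window c b h y eta ->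
  [/\ `|y.1| <= B * a, `|y.2| <= B * a & `|eta| <= B * a].
Proof.
move=> a0 b0 h0 B0 cB ba ha [hy heta].
have le (u v : R) : 0 < v -> v <= a -> u <= c * v -> u <= B * a.
  move=> v0 va uv; apply: (le_trans uv); apply: (@le_trans _ _ (B * v)).
    by rewrite ler_wpM2r// ltW.
  by rewrite ler_wpM2l.
split.
- exact: le_trans (enorm2_ge1 y) (le _ _ b0 ba hy).
- exact: le_trans (enorm2_ge2 y) (le _ _ b0 ba hy).
- exact: le heta.
Qed.

Lemma cross_image_bound (R : realType) (A : set (R * R)) (c M : R) :
  bounded_piecewise_smooth_domain A ->
  exists C B, [/\ 0 <= C, 0 <= B & forall (k L a b h : R) (y y' : R * R) (eta : R) (alpha : 'M[R[i]]_3),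
    0 < k -> 0 < a -> 0 < b -> 0 < h -> b <= a -> h <= a ->
    64 * (B * a) <= L -> L <= k * a ^+ 2 ->
    in_window c b h y eta -> in_window c b h y' eta ->
    fnorm alpha <= M -> y <> y' ->
    fnorm (kirchhoff_image (scaled_array a A) k (point3 y' (L + eta)) alpha
             (point3 y (L + eta))) <=
    a ^+ 4 / L ^+ 4 * (C * (L / (a * k * enorm2 (y - y'))) ^+ 2 +
      C * (a ^+ 4 * (k * a ^+ 2 / L) ^+ 2 / L ^+ 4))].
Proof.
move=> domA; have [bA mA _ _ _] := domA.
have [r r0 Ar] := bounded_set_box bA.
pose B := 1 + r + `|c|.
have B1 : 1 <= B by rewrite /B -addrA lerDl addr_ge0.
have cB : c <= B by rewrite /B (le_trans (ler_norm c))// lerDr addr_ge0.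
have rB : r <= B by rewrite /B addrAC lerDr addr_ge0.
have AB : A `<=` box 0 B.
  by move=> x /Ar /boxP[h1 h2]; apply/boxP; split; [exact: le_trans h1 rB|exact: le_trans h2 rB].
have B0 : 0 <= B by exact: le_trans B1.
have [K K0 hK] := cross_kernel_bound domA B1 AB.
exists (54 * K ^+ 2 * `|M|), B; split => //.
  exact: mulr_ge0 (mulr_ge0 (ler0n _ _) (sqr_ge0 _)) (normr_ge0 _).
move=> k L a b h y y' eta alpha k0 a0 b0 h0 ba ha BL ka wy wy' hM yy'.
have [y1 y2 e1] := in_window_bounds a0 b0 h0 B0 cB ba ha wy.
have [y1' y2' _] := in_window_bounds a0 b0 h0 B0 cB ba ha wy'.
have hz : `|L + eta - L| <= B * a by rewrite addrC addKr.
have mB : measurable (scaled_array a A : set (plane R)) by exact: measurable_scaled_array.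
have Bc : scaled_array a A `<=` box 0 (B * a).
  by rewrite mulrC; exact: scaled_array_box.
have ac : a <= B * a by rewrite ler_peMl// ltW.
have [K' _ hK'] := kernel_integral_near R.
have [iK _] := hK' _ _ _ _ _ _ _ _ mB Bc k0 a0 ac BL ka y1 y2 y1' y2' hz.
rewrite (kirchhoff_imageE _ mB iK).
have hH := hK _ _ _ _ _ _ k0 a0 BL ka y1 y2 y1' y2' hz yy'.
set X := L / _ in hH *; set w := k * a ^+ 4 / L ^+ 3 in hH *.
set e := a ^+ 2 / L ^+ 2 * _ in hH.
have hM' : fnorm alpha <= `|M| by exact: le_trans hM (ler_norm M).
apply: (le_trans (fnorm_congr_le hH hH hM')).
have L0 : 0 < L by apply: lt_le_trans BL; rewrite !mulr_gt0// (lt_le_trans ltr01).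
have -> : a ^+ 4 * (k * a ^+ 2 / L) ^+ 2 / L ^+ 4 = w ^+ 2.
  by rewrite /w; field; rewrite gt_eqF.
clear - a0 L0 K0.
rewrite (_ : 27 * _ = a ^+ 4 / L ^+ 4 * (27 * K ^+ 2 * `|M| * (X + w) ^+ 2)); last first.
  by rewrite /e; field; rewrite gt_eqF.
have aL : 0 <= a ^+ 4 / L ^+ 4 by exact: divr_ge0 (exprn_ge0 _ (ltW a0)) (exprn_ge0 _ (ltW L0)).
apply: ler_wpM2l => //.
rewrite (_ : _ + _ = 27 * K ^+ 2 * `|M| * (2 * (X ^+ 2 + w ^+ 2))); last by ring.
apply: ler_wpM2l; last exact: sqr_add_le.
exact: mulr_ge0 (mulr_ge0 (ler0n _ _) (sqr_ge0 _)) (normr_ge0 _).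
Qed.

Lemma fraunhofer_phase_diag (R : realType) (k z : R) (y x : R * R) :
  let xi := fraunhofer_xi k z y y in
  fraunhofer_psi k z y y + (xi.1 * x.1 + xi.2 * x.2) = 0.
Proof. by rewrite /fraunhofer_psi /fraunhofer_xi /=; ring. Qed.

Lemma integralC_cst1 (R : realType) (A : set (plane R)) : measurable A ->
  integralC A (fun _ => 1) = (fine (area A))%:C.
Proof.
move=> mA; rewrite /integralC /=.
by rewrite !(Rintegral_cst area mA) mul1r mul0r.
Qed.

Lemma fnorm_congr_near (R : realType) (H P M : 'M[R[i]]_3) (s rho m : R) :
  0 <= s -> (forall i j, Normc.normc (P i j) <= 1) ->
  (forall i j, Normc.normc (H i j - s%:C * P i j) <= rho) -> fnorm M <= m ->
  fnorm (H *m M *m H^T - (s ^+ 2)%:C *: (P *m M *m P^T)) <= 81 * (rho * (rho + 2 * s) * m).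
Proof.
move=> s0 hP hE hM.
pose E := H - s%:C *: P.
have hE' i j : Normc.normc (E i j) <= rho by rewrite !mxE; exact: hE.
have hsP i j : Normc.normc ((s%:C *: P) i j) <= s.
  by rewrite mxE Normc.normcM normc_real (ger0_norm s0) ler_piMr.
have hH i j : Normc.normc (H i j) <= rho + s.
  rewrite (_ : H i j = E i j + (s%:C *: P) i j); last by rewrite !mxE subrK.
  by apply: (le_trans (normcD _ _)); exact: lerD.
have -> : H *m M *m H^T - (s ^+ 2)%:C *: (P *m M *m P^T) =
    E *m M *m H^T + (s%:C *: P) *m M *m E^T.
  have -> : (s ^+ 2)%:C *: (P *m M *m P^T) = (s%:C *: P) *m M *m (s%:C *: P)^T.
    have -> : (s%:C *: P)^T = s%:C *: P^T by apply/matrixP => i j; rewrite !mxE.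
    by rewrite -scalemxAr -!scalemxAl scalerA expr2 rmorphM.
  rewrite /E; move: (s%:C *: P) => S.
  by rewrite raddfB mulmxBr !mulmxBl addrA subrK.
have h1 := fnorm_congr_le hE' hH hM.
have h2 := fnorm_congr_le hsP hE' hM.
apply: (le_trans (fnormD_le h1 h2)).
by rewrite le_eqVlt; apply/orP; left; apply/eqP; ring.
Qed.

Lemma disk_image_bound (R : realType) (c M : R) :
  exists C B, [/\ 0 <= C, 0 <= B & forall (k L a b h : R) (y : R * R) (eta : R) (alpha : 'M[R[i]]_3),
    0 < k -> 0 < a -> 0 < b -> 0 < h -> b <= a -> h <= a ->
    64 * (B * a) <= L -> L <= k * a ^+ 2 -> a / L + k * a ^+ 4 / L ^+ 3 <= 1 ->
    in_window c b h y eta -> fnorm alpha <= M ->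
    fnorm (kirchhoff_image (disk_array a) k (point3 y (L + eta)) alpha
             (point3 y (L + eta)) -
           (a ^+ 4 / ((16 * pi) ^+ 2 * L ^+ 4))%:C *: cross_range_block alpha) <=
    C * (a ^+ 4 / L ^+ 4 * (a / L + k * a ^+ 4 / L ^+ 3))].
Proof.
pose B := 1 + `|c|.
have B1 : 1 <= B by rewrite /B lerDl.
have cB : c <= B by rewrite /B (le_trans (ler_norm c))// lerDr.
have B0 : 0 <= B by exact: le_trans B1.
have [K K0 hK] := kernel_integral_near R.
pose K' := K * B ^+ 6.
have K'0 : 0 <= K' by exact: mulr_ge0 K0 (exprn_ge0 _ B0).
exists (81 * (K' * (K' + 2)) * `|M|), B; split => //.
  apply: mulr_ge0; last exact: normr_ge0.
  exact: mulr_ge0 (ler0n _ _) (mulr_ge0 K'0 (addr_ge0 K'0 (ler0n _ 2))).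
move=> k L a b h y eta alpha k0 a0 b0 h0 ba ha BL ka.
set tau := a / L + _ => tau1 wy hM.
have [y1 y2 e1] := in_window_bounds a0 b0 h0 B0 cB ba ha wy.
have hz : `|L + eta - L| <= B * a by rewrite addrC addKr.
have ac : a <= B * a by rewrite ler_peMl// ltW.
have mB := measurable_disk a.
have Bc : disk_array a `<=` box 0 (B * a).
  move=> x /disk_array_box /boxP[h1 h2]; apply/boxP.
  by split; [exact: le_trans h1 ac|exact: le_trans h2 ac].
have [iK hH] := hK _ _ _ _ _ _ _ _ mB Bc k0 a0 ac BL ka y1 y2 y1 y2 hz.
rewrite (kirchhoff_imageE _ mB iK).
have L0 : 0 < L by apply: lt_le_trans BL; rewrite !mulr_gt0// (lt_le_trans ltr01).
have aL : 0 <= a ^+ 2 / L ^+ 2 by exact: divr_ge0 (exprn_ge0 _ (ltW a0)) (exprn_ge0 _ (ltW L0)).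
have p0 := pi_gt0 R.
pose s : R := pi * a ^+ 2 * (16 * pi ^+ 2 * L ^+ 2)^-1.
have sE : s = (16 * pi)^-1 * (a ^+ 2 / L ^+ 2).
  by rewrite /s; move: pi p0 => p p0; field; rewrite !gt_eqF.
have q1 : 0 <= ((16 * pi)^-1 : R) <= 1.
  have h16 : 1 <= 16 * pi :> R.
    rewrite (le_trans (le_trans (ler1n _ 2) (pi_ge2 R)))// ler_peMl// ?(ltW p0)//.
    by rewrite ler1n.
  by rewrite invr_ge0 (le_trans ler01 h16)/= invf_le1// (lt_le_trans ltr01 h16).
have /andP[q0 q1'] := q1.
have s0 : 0 <= s by rewrite sE mulr_ge0.
have s1 : s <= a ^+ 2 / L ^+ 2 by rewrite sE ler_piMl.
have -> : a ^+ 4 / ((16 * pi) ^+ 2 * L ^+ 4) = s ^+ 2.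
  by rewrite sE; move: pi p0 => p p0; field; rewrite !gt_eqF.
rewrite cross_range_blockE.
have tau0 : 0 <= tau.
  apply: addr_ge0; first exact: divr_ge0 (ltW a0) (ltW L0).
  exact: divr_ge0 (mulr_ge0 (ltW k0) (exprn_ge0 _ (ltW a0))) (exprn_ge0 _ (ltW L0)).
pose rho := K' * (a ^+ 2 / L ^+ 2) * tau.
have rho0 : 0 <= rho by exact: mulr_ge0 (mulr_ge0 K'0 aL) tau0.
have hrho : K * ((B * a) ^+ 2 / L ^+ 2) * (B * a / L + k * (B * a) ^+ 4 / L ^+ 3) <= rho.
  rewrite (_ : K * _ * _ = K * B ^+ 2 * (a ^+ 2 / L ^+ 2) *
    (B * (a / L) + B ^+ 4 * (k * a ^+ 4 / L ^+ 3))); last by ring.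
  rewrite (_ : rho = K * B ^+ 2 * (a ^+ 2 / L ^+ 2) * (B ^+ 4 * tau)); last first.
    by rewrite /rho /K'; ring.
  apply: ler_wpM2l; first exact: mulr_ge0 (mulr_ge0 K0 (exprn_ge0 _ B0)) aL.
  rewrite /tau mulrDr lerD2r; apply: ler_wpM2r; first exact: divr_ge0 (ltW a0) (ltW L0).
  exact: ler_eXnr.
have hE i j : Normc.normc (integral_mx (disk_array a) (kernel k (point3 y (L + eta)) (point3 y (L + eta))) i j -
    s%:C * transverse R i j) <= rho.
  apply: le_trans hrho; apply: le_trans (hH i j); rewrite le_eqVlt; apply/orP; left; apply/eqP.
  congr (Normc.normc (_ - _)); rewrite mulrA; congr (_ * _).
  rewrite (_ : (fun x : R * R => expi _) = (fun _ => 1)); last first.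
    by apply/funext => x; rewrite fraunhofer_phase_diag /expi cos0 sin0.
  by rewrite (integralC_cst1 mB) area_disk//= -(rmorphM (real_complex R)).
have hM' : fnorm alpha <= `|M| by exact: le_trans hM (ler_norm M).
apply: (le_trans (fnorm_congr_near s0 (@normc_transverse R) hE hM')).
rewrite (_ : _ * `|M| * _ = 81 * (rho * ((K' + 2) * (a ^+ 2 / L ^+ 2)) * `|M|)); last first.
  by rewrite /rho; field; rewrite gt_eqF.
apply: ler_wpM2l; first exact: ler0n.
apply: ler_wpM2r; first exact: normr_ge0.
apply: ler_wpM2l; first exact: rho0.
rewrite [leRHS]mulrDl; apply: lerD; last exact: ler_wpM2l (ler0n _ 2) _ _ s1.
exact: ler_piMr (mulr_ge0 K'0 aL) tau1.
Qed.

(** * The asymptotic regime *)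

Section AsymptoticRegime.
Context {R : realType} {T : Type} (F : filter_on T) (FF : ProperFilter F)
  (k L a b h : T -> R) (regime : fraunhofer F k L a b h).

Let pos t := fraunhofer_pos regime t.

Let near_small (f : T -> R) : f @ F --> (0 : R) ->
  forall eps, 0 < eps -> \forall t \near F, f t <= eps.
Proof.
move=> /cvgr0Pnorm_le f0 eps e0; near=> t.
by apply: le_trans (ler_norm _) _; near: t; exact: f0.
Unshelve. all: by end_near. Qed.

Let near_kL (eps : R) : 0 < eps -> \forall t \near F, L t <= eps * (k t * a t ^+ 2).
Proof.
move=> e0; near=> t.
have [k0 L0 a0 _ _] := pos t.
have : (cst 1 : T -> R) t / Theta k L a t <= eps.
  by near: t; exact: near_small (fraunhofer_Thetaa regime) _ e0.
rewrite /= /Theta div1r invf_div ler_pdivrMr //.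
by rewrite mulr_gt0 // exprn_gt0.
Unshelve. all: by end_near. Qed.

Lemma fraunhofer_aspect (m : R) : 0 <= m -> \forall t \near F, m * a t <= L t.
Proof.
move=> m0; have m1 : 0 < m + 1 by rewrite ltr_wpDl.
near=> t.
have [_ L0 a0 _ _] := pos t.
have : a t / L t <= (m + 1)^-1.
  by near: t; apply: (near_small (fraunhofer_aL regime)); rewrite invr_gt0.
rewrite ler_pdivrMr // mulrC ler_pdivlMr // mulrDr mulr1 mulrC => /(le_trans _); apply.
by rewrite lerDl ltW.
Unshelve. all: by end_near. Qed.

Lemma fraunhofer_near_sides : \forall t \near F,
  [/\ L t <= k t * a t ^+ 2, b t <= a t & h t <= a t].
Proof.
have /eqO_exP [K K0 khK] := fraunhofer_kh regime.
near=> t.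
have [k0 L0 a0 b0 h0] := pos t.
have La : L t <= k t * a t ^+ 2.
  by rewrite -[leRHS]mul1r; near: t; exact: near_kL.
split=> //.
- have : Theta k L b t / 1 <= 1.
    by near: t; exact: near_small (fraunhofer_Thetab regime) _ ltr01.
  rewrite /= /Theta divr1 ler_pdivrMr // mul1r => /le_trans /(_ La).
  by rewrite ler_pM2l // ler_sqr // nnegrE ltW.
- have KaL : K * a t <= L t by near: t; exact/fraunhofer_aspect/ltW.
  have khKt : k t * h t <= K.
    have : `|(k \* h) t| <= K * `|(cst 1 : T -> R) t| by near: t.
    by rewrite /= normr1 mulr1; apply: le_trans; exact: ler_norm.
  have Kka : K <= k t * a t.
    by rewrite -(ler_pM2r a0) -mulrA -expr2; exact: le_trans KaL La.
  by rewrite -(ler_pM2l k0); exact: le_trans khKt Kka.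
Unshelve. all: by end_near. Qed.

Lemma fraunhofer_paraxial_cvg0 :
  (fun t => k t * a t ^+ 4 / L t ^+ 3) @ F --> (0 : R).
Proof.
suff -> : (fun t => k t * a t ^+ 4 / L t ^+ 3) =
    (fun t => Theta k L a t / (L t ^+ 2 / a t ^+ 2)).
  exact: fraunhofer_Thetaa_ub regime.
apply/funext => t; have [k0 L0 a0 _ _] := pos t.
by rewrite /Theta; field; rewrite ?gt_eqF.
Qed.

Lemma fraunhofer_error_cvg0 :
  (fun t => a t / L t + k t * a t ^+ 4 / L t ^+ 3) @ F --> (0 : R).
Proof.
rewrite -(addr0 0).
exact: cvgD (fraunhofer_aL regime) fraunhofer_paraxial_cvg0.
Qed.

Lemma fraunhofer_sqr_error_cvg0 :
  (fun t => a t ^+ 4 * Theta k L a t ^+ 2 / L t ^+ 4) @ F --> (0 : R).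
Proof.
suff -> : (fun t => a t ^+ 4 * Theta k L a t ^+ 2 / L t ^+ 4) =
    (fun t => k t * a t ^+ 4 / L t ^+ 3) \* (fun t => k t * a t ^+ 4 / L t ^+ 3).
  rewrite -(mulr0 0).
  exact: cvgM fraunhofer_paraxial_cvg0 fraunhofer_paraxial_cvg0.
apply/funext => t /=; have [k0 L0 a0 _ _] := pos t.
by rewrite /Theta; field; rewrite gt_eqF.
Qed.

End AsymptoticRegime.

Theorem proposition3p1 (R : realType) (T : Type) (F : filter_on T)
    (FF : ProperFilter F)
    (k L a b h : T -> R) (regime : fraunhofer F k L a b h)
    (c M : R) :
  (forall (A : set (R * R)), bounded_piecewise_smooth_domain A ->
    exists (C : R) (e e1 e2 : T -> R),
      [/\ forall t, e t = e1 t + e2 t,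
          e =o_F (cst 1 : T -> R),
          e1 =O_F (fun t => a t ^+ 4 * Theta k L a t ^+ 2 / L t ^+ 4),
          e2 =O_F (fun t => Theta k L b t ^+ 2) &
          \forall t \near F,
            forall (y ystar : R * R) (etastar : R) (alpha : 'M[R[i]]_3),
              in_window c (b t) (h t) y etastar ->
              in_window c (b t) (h t) ystar etastar ->
              alpha^T = alpha -> fnorm alpha <= M -> y <> ystar ->
              fnorm (kirchhoff_image (scaled_array (a t) A) (k t)
                       (point3 ystar (L t + etastar)) alpha
                       (point3 y (L t + etastar)))
              <= a t ^+ 4 / L t ^+ 4 *
                 (C * (L t / (a t * k t * enorm2 (y - ystar))) ^+ 2 + e t)])
  /\
  (exists e : T -> R,
    e =o_F (fun t => a t ^+ 4 / L t ^+ 4) /\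
    \forall t \near F,
      forall (ystar : R * R) (etastar : R) (alpha : 'M[R[i]]_3),
        in_window c (b t) (h t) ystar etastar ->
        alpha^T = alpha -> fnorm alpha <= M ->
        fnorm (kirchhoff_image (disk_array (a t)) (k t)
                 (point3 ystar (L t + etastar)) alpha
                 (point3 ystar (L t + etastar))
               - (a t ^+ 4 / ((16 * pi) ^+ 2 * L t ^+ 4))%:C *:
                   cross_range_block alpha)
        <= e t).
Proof.
have pos t := fraunhofer_pos regime t.
split.
- move=> A dA; have [C [B [C0 B0 bound]]] := cross_image_bound c M dA.
  exists C, (fun t => C * (a t ^+ 4 * Theta k L a t ^+ 2 / L t ^+ 4)),
    (fun t => C * (a t ^+ 4 * Theta k L a t ^+ 2 / L t ^+ 4)), (fun=> 0); split.
  + by move=> t; rewrite addr0.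
  + apply/eqoP => eps e0.
    have : (fun t => C * (a t ^+ 4 * Theta k L a t ^+ 2 / L t ^+ 4)) @ F --> (0 : R).
      rewrite -(mulr0 C).
      exact: cvgM (cvg_cst C) (fraunhofer_sqr_error_cvg0 regime).
    move=> /cvgr0Pnorm_le /(_ _ e0).
    by apply: filterS => t; rewrite /= normr1 mulr1.
  + apply/eqO_exP; exists (C + 1); first by rewrite ltr_wpDl.
    apply: nearW => t; rewrite normrM ger0_norm // ler_wpM2r ?normr_ge0 //.
    by rewrite lerDl ler01.
  + apply/eqO_exP; exists 1 => //.
    by apply: nearW => t; rewrite normr0 mul1r normr_ge0.
  + have B64 : 0 <= 64 * B by apply: mulr_ge0 => //; exact: ler0n.
    near=> t => y ystar etastar alpha wy wys _ alphaM ne.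
    have [k0 L0 a0 b0 h0] := pos t.
    have [Lka ba ha] : [/\ L t <= k t * a t ^+ 2, b t <= a t & h t <= a t].
      by near: t; exact: fraunhofer_near_sides regime.
    have BL : 64 * (B * a t) <= L t.
      by rewrite mulrA; near: t; exact: (fraunhofer_aspect regime B64).
    exact: (bound _ _ _ _ _ _ _ _ _ k0 a0 b0 h0 ba ha BL Lka wy wys alphaM ne).
- have [C [B [C0 B0 bound]]] := disk_image_bound c M.
  exists (fun t => C * (a t ^+ 4 / L t ^+ 4 *
    (a t / L t + k t * a t ^+ 4 / L t ^+ 3))); split.
  + apply/eqoP => eps e0.
    have : (fun t => C * (a t / L t + k t * a t ^+ 4 / L t ^+ 3)) @ F --> (0 : R).
      rewrite -(mulr0 C).
      exact: cvgM (cvg_cst C) (fraunhofer_error_cvg0 regime).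
    move=> /cvgr0Pnorm_le /(_ _ e0).
    apply: filterS => t /= le_eps.
    by rewrite mulrCA normrM mulrC ler_wpM2r ?normr_ge0.
  + have B64 : 0 <= 64 * B by apply: mulr_ge0 => //; exact: ler0n.
    have /cvgr0Pnorm_le /(_ _ ltr01) taule := fraunhofer_error_cvg0 regime.
    near=> t => ystar etastar alpha wys _ alphaM.
    have [k0 L0 a0 b0 h0] := pos t.
    have [Lka ba ha] : [/\ L t <= k t * a t ^+ 2, b t <= a t & h t <= a t].
      by near: t; exact: fraunhofer_near_sides regime.
    have BL : 64 * (B * a t) <= L t.
      by rewrite mulrA; near: t; exact: (fraunhofer_aspect regime B64).
    have tau1 : a t / L t + k t * a t ^+ 4 / L t ^+ 3 <= 1.
      by apply: le_trans (ler_norm _) _; near: t; exact: taule.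
    exact: (bound _ _ _ _ _ _ _ _ k0 a0 b0 h0 ba ha BL Lka tau1 wys alphaM).
Unshelve. all: by end_near. Qed.
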